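(* For an odd function $f:\{-1,1\}^n\to\{-1,1\}$ let $R(f)$ denote the probability of a rational outcome when $f$ is used as a social choice function to aggregate the rankings of three candidates by $n$ voters, each voter choosing independently and uniformly one of the 6 possible linear rankings. Then: (i) For every $\epsilon>0$ there is $\tau>0$ such that for every $n$ and every odd (hence balanced) $f:\{-1,1\}^n\to\{-1,1\}$ with $\mathrm{Inf}_i(f)\le\tau$ for all $i$, $$R(f)\le \tfrac34+\tfrac{3}{2\pi}\arcsin(1/3)+\epsilon .$$ (ii) For every $\epsilon>0$ there is $n_0$ such that for every $n\ge n_0$ and every odd (hence balanced) transitive-symmetric $f:\{-1,1\}^n\to\{-1,1\}$, $$R(f)\le \tfrac34+\tfrac{3}{2\pi}\arcsin(1/3)+\epsilon .$$ (iii) The majority function achieves this bound: $R(\mathrm{Maj}_n)\to \tfrac34+\tfrac{3}{2\pi}\arcsin(1/3)$ as $n\to\infty$ through odd integers.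
   Context: $f$ is odd if $f(-x)=-f(x)$; balanced if $\mathbf{E}[f]=0$ under the uniform measure. $\mathrm{Inf}_i(f)=\mathbf{E}_x[\mathrm{Var}_{x_i}[f(x)]]=\sum_{S\ni i}\hat f(S)^2$ under uniform measure on $\{-1,1\}^n$. $f$ is transitive-symmetric if for all $1\le i<j\le n$ there is a permutation $\sigma$ of $[n]$ with $\sigma(i)=j$ and $f(x_1,\dots,x_n)=f(x_{\sigma(1)},\dots,x_{\sigma(n)})$ for all $x$. $\mathrm{Maj}_n(x)=\mathrm{sgn}(x_1+\dots+x_n)$ for odd $n$. Social choice setting: there are three candidates $A,B,C$, and each voter has a linear ranking of them. For each pair of candidates, say $A$ versus $B$, the $n$ voters' preferences are encoded as a vector in $\{-1,1\}^n$ (entry $1$ if the voter prefers the first candidate, $-1$ otherwise), and $f$ applied to this vector determines which of the two is globally preferred ($1$: the first, $-1$: the second). The same is done for the other two pairs. The outcome is non-rational if the resulting global preference relation is cyclic ($A$ over $B$ over $C$ over $A$, or the other cycle), and rational otherwise. *)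

(* Defs.v *)
(* Mathematical Components + MathComp-Analysis *)
From mathcomp Require Import all_boot all_order all_fingroup all_algebra.
From mathcomp Require Import boolp classical_sets reals topology.
From mathcomp Require Import normedtype sequences trigo.

Set Implicit Arguments.
Unset Strict Implicit.
Unset Printing Implicit Defensive.

Import Order.TTheory GRing.Theory Num.Theory.
Import numFieldNormedType.Exports.

Local Open Scope ring_scope.

(* The set {-1,1} is encoded by bool, [true] standing for 1 and [false] for -1;
   hence negation is x |-> -x, and [sgnv] gives the numerical value. *)
Definition cube (n : nat) := {ffun 'I_n -> bool}.

Definition bfun (n : nat) := cube n -> bool.

Definition sgnv (R : realType) (b : bool) : R := if b then 1 else -1.

Definition cube_opp n (x : cube n) : cube n := [ffun i => ~~ x i].

Definition odd_bfun n (f : bfun n) : Prop :=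
  forall x : cube n, f (cube_opp x) = ~~ f x.

(* Expectation, variance and probability under the uniform measure on T. *)
Definition uexpect (R : realType) (T : finType) (g : T -> R) : R :=
  (\sum_(t : T) g t) / #|T|%:R.

Definition uvariance (R : realType) (T : finType) (g : T -> R) : R :=
  uexpect (fun t => (g t - uexpect g) ^+ 2).

Definition uprob (R : realType) (T : finType) (E : pred T) : R :=
  #|E|%:R / #|T|%:R.

Definition balanced (R : realType) n (f : bfun n) : Prop :=
  uexpect (fun x : cube n => sgnv R (f x)) = 0.

Definition set_coord n (x : cube n) (i : 'I_n) (b : bool) : cube n :=
  [ffun j => if j == i then b else x j].

(* E_x[Var_{x_i}[f(x)]]: only coordinate i is resampled in the inner variance. *)
Definition influence (R : realType) n (i : 'I_n) (f : bfun n) : R :=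
  uexpect (fun x : cube n =>
    uvariance (fun b : bool => sgnv R (f (set_coord x i b)))).

Definition transitive_symmetric n (f : bfun n) : Prop :=
  forall i j : 'I_n, (i < j)%N ->
    exists2 s : 'S_n, s i = j & forall x : cube n, f x = f [ffun k => x (s k)].

(* For odd n the sum below never vanishes, so this is its sign: see [majE]. *)
Definition Maj n : bfun n := fun x => 0 < \sum_(i < n) (if x i then 1 else -1) :> int.

Definition candA : 'I_3 := @Ordinal 3 0 isT.
Definition candB : 'I_3 := @Ordinal 3 1 isT.
Definition candC : 'I_3 := @Ordinal 3 2 isT.

(* A linear ranking r of the candidates: r a is the position of a, the position
   0 being that of the favourite. *)
Definition ranking := 'S_3.

Definition prefers (r : ranking) (a b : 'I_3) : bool := (r a < r b)%N.

(* The uniform measure on profiles is the product of the uniform measures on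
   the rankings of the voters, i.e. voters are independent and uniform. *)
Definition profile (n : nat) := {ffun 'I_n -> ranking}.

(* [true] if a is globally preferred to b, [false] if b is preferred to a. *)
Definition contest n (f : bfun n) (p : profile n) (a b : 'I_3) : bool :=
  f [ffun v => prefers (p v) a b].

Definition cyclic_outcome n (f : bfun n) (p : profile n) : bool :=
  [&& contest f p candA candB, contest f p candB candC & contest f p candC candA]
  || [&& ~~ contest f p candA candB, ~~ contest f p candB candC
       & ~~ contest f p candC candA].

Definition rational_prob (R : realType) n (f : bfun n) : R :=
  uprob R (fun p : profile n => ~~ cyclic_outcome f p).

Definition rational_bound (R : realType) : R :=
  3 / 4 + 3 / (2 * pi) * asin (1 / 3).

Lemma odd_balanced (R : realType) n (f : bfun n) : odd_bfun f -> balanced R f.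
Proof.
move=> fodd; rewrite /balanced /uexpect; set s := (X in X / _).
have oppK : involutive (@cube_opp n).
  by move=> x; apply/ffunP => i; rewrite !ffunE negbK.
have sE : s = - s.
  rewrite {1}/s (reindex_inj (inv_inj oppK)) /= /s -sumrN.
  by apply: eq_bigr => x _; rewrite fodd /sgnv; case: (f x); rewrite ?opprK.
suff -> : s = 0 by rewrite mul0r.
apply/eqP; rewrite -[_ == 0]/((2 == 0)%N || (s == 0)) -mulrn_eq0.
by rewrite mulr2n {1}sE addNr.
Qed.

Lemma majE (R : realType) n (x : cube n) : odd n ->
  sgnv R (Maj x) = Num.sg (\sum_(i < n) sgnv R (x i)).
Proof.
move=> nodd; set z : int := \sum_(i < n) (if x i then 1 else -1).
have -> : \sum_(i < n) sgnv R (x i) = z%:~R.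
  rewrite /z rmorph_sum; apply: eq_bigr => i _.
  by rewrite /sgnv; case: (x i); rewrite ?rmorphN ?rmorph1.
have zE : z = n%:Z - 2 * \sum_(i < n) (if x i then 0 else 1).
  rewrite mulr_sumr -[in n%:Z](card_ord n) -sum1_card -natz natr_sum -sumrB.
  by apply: eq_bigr => i _; case: (x i).
have z0 : z != 0.
  apply/eqP => z0; move: zE; rewrite z0 => /esym/eqP; rewrite subr_eq0 => /eqP nE.
  by move: (congr1 absz nE); rewrite abszM /= => nE'; move: nodd; rewrite nE' oddM.
rewrite sgrEz sgz_int /Maj -/z /sgnv.
case: (ltrgtP 0 z) => [z_gt0|z_lt0|z_eq0].
- by rewrite (gtr0_sgz z_gt0).
- by rewrite (ltr0_sgz z_lt0) rmorphN rmorph1.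
- by rewrite -z_eq0 eqxx in z0.
Qed.

(* Main.v *)
(* The probability of a rational outcome of an odd f is 3/4 + 3/4 Stab(f), where
   Stab is the noise stability of f at correlation 1/3, so the three claims are
   about Stab, to be compared with (2/pi) asin(1/3).

   The upper bound is "majority is stablest", proved on the discrete cube after
   De, Mossel and Neeman.  Let J(x, y) be the probability that two Gaussians of
   correlation rho fall in half-lines of probabilities x and y.  Its Hessian
   with the mixed term weighted by rho is negative semidefinite, so averaging J
   over one pair of rho-correlated bits can only decrease it, up to third-order
   errors.  Averaging out the coordinates one at a time bounds the mean of
   J(g(x), g(y)) by J(E g, E g) plus the sum of the third moments of the
   martingale differences of g.  For g a slightly noisy version of f that sum is
   small when all influences are, by Bonami's inequality; J dominates the
   product, and J(1/2, 1/2) = 1/4 + asin(rho)/(2 pi).  A transitive-symmetric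
   function need not have small influences, but its noisy version does, since
   its total noisy influence is bounded independently of n.

   For majority, the weight of level 2l+1 is determined by the Fourier
   coefficients of the indicator of a tie among 2m voters, which satisfy a
   two-term recurrence because a tie annihilates the sum of the votes; Wallis's
   product then bounds them below by the Taylor coefficients of (2/pi) asin. *)
Require Import Defs.
From mathcomp Require Import all_boot all_order all_fingroup all_algebra.
From mathcomp Require Import ring lra zify.
From mathcomp Require Import boolp classical_sets functions reals topology.
From mathcomp Require Import interval_inference ereal normedtype sequences.
From mathcomp Require Import realfun exp trigo derive measure lebesgue_measure.
From mathcomp Require Import lebesgue_integral ftc gauss_integral.

Set Implicit Arguments.
Unset Strict Implicit.
Unset Printing Implicit Defensive.

Import Order.TTheory GRing.Theory Num.Theory.
Import numFieldNormedType.Exports.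

Local Open Scope ring_scope.

(** * Fourier analysis and noise on the discrete cube *)

Section ConsFunctions.
Variable T : Type.

Definition fcons n (t : T) (x : {ffun 'I_n -> T}) : {ffun 'I_n.+1 -> T} :=
  [ffun i => oapp x t (unlift ord0 i)].

Definition fbehead n (x : {ffun 'I_n.+1 -> T}) : {ffun 'I_n -> T} :=
  [ffun i => x (lift ord0 i)].

Lemma fcons0 n t (x : {ffun 'I_n -> T}) : fcons t x ord0 = t.
Proof. by rewrite ffunE unlift_none. Qed.

Lemma fconsS n t (x : {ffun 'I_n -> T}) i : fcons t x (lift ord0 i) = x i.
Proof. by rewrite ffunE liftK. Qed.

Lemma fconsK n t (x : {ffun 'I_n -> T}) : fbehead (fcons t x) = x.
Proof. by apply/ffunP => i; rewrite ffunE fconsS. Qed.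

Lemma fcons_behead n (x : {ffun 'I_n.+1 -> T}) : fcons (x ord0) (fbehead x) = x.
Proof.
apply/ffunP => i; case: (unliftP ord0 i) => [j ->|->].
  by rewrite fconsS ffunE.
by rewrite fcons0.
Qed.

End ConsFunctions.

Lemma sum_fcons (V : nmodType) (T : finType) n (G : {ffun 'I_n.+1 -> T} -> V) :
  \sum_x G x = \sum_t \sum_x G (fcons t x).
Proof.
rewrite pair_big /=.
rewrite (reindex (fun p : T * {ffun 'I_n -> T} => fcons p.1 p.2)) //=.
exists (fun x : {ffun 'I_n.+1 -> T} => (x ord0, fbehead x)) => [[t x] _|x _] /=.
  by rewrite fcons0 fconsK.
by rewrite fcons_behead.
Qed.

Lemma sum_ffun0 (V : nmodType) (T : finType) (G : {ffun 'I_0 -> T} -> V) x :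
  \sum_y G y = G x.
Proof.
have E y : y = x by apply/ffunP; case.
by rewrite (big_pred1 x) // => y /=; rewrite (E y) eqxx.
Qed.

Section Discrete.
Variable R : realType.
Local Notation sgnv := (sgnv R).

Definition cnil : cube 0 := [ffun=> true].

Lemma uexpect_ffun0 (T : finType) (g : {ffun 'I_0 -> T} -> R) x : uexpect g = g x.
Proof. by rewrite /uexpect (sum_ffun0 _ x) card_ffun card_ord expn0 divr1. Qed.

Lemma uexpect_fcons (T : finType) n (g : {ffun 'I_n.+1 -> T} -> R) :
  uexpect g = uexpect (fun t => uexpect (fun x => g (fcons t x))).
Proof.
rewrite /uexpect sum_fcons -mulr_suml -mulrA; congr (_ * _).
by rewrite !card_ffun !card_ord expnS natrM invfM mulrC.
Qed.

Lemma uexpect_bool (g : bool -> R) : uexpect g = (g true + g false) / 2.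
Proof. by rewrite /uexpect big_bool card_bool. Qed.

Lemma uexpect_cst (T : finType) (x : T) (c : R) : uexpect (fun _ : T => c) = c.
Proof.
rewrite /uexpect sumr_const -[c *+ _]mulr_natr mulfK // pnatr_eq0 -lt0n.
by apply/card_gt0P; exists x.
Qed.

Section Uexpect.
Variable T : finType.
Implicit Types g h : T -> R.

Lemma eq_uexpect g h : g =1 h -> uexpect g = uexpect h.
Proof. by move=> gh; congr (_ / _); apply: eq_bigr => t _; apply: gh. Qed.

Lemma uexpectD g h : uexpect (fun t => g t + h t) = uexpect g + uexpect h.
Proof. by rewrite /uexpect big_split mulrDl. Qed.

Lemma uexpectZ c g : uexpect (fun t => c * g t) = c * uexpect g.
Proof. by rewrite /uexpect -mulr_sumr mulrA. Qed.

Lemma le_uexpect g h : (forall t, g t <= h t) -> uexpect g <= uexpect h.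
Proof. by move=> gh; rewrite ler_wpM2r ?invr_ge0 ?ler0n // ler_sum. Qed.

Lemma uexpect_ge0 g : (forall t, 0 <= g t) -> 0 <= uexpect g.
Proof. by move=> g0; rewrite divr_ge0 ?ler0n // sumr_ge0. Qed.

(** Lagrange's identity: the mean of the square of [g t * h u - g u * h t] over independent t and u
    is twice the difference of the two sides. *)
Lemma uexpect_CauchySchwarz g h :
  uexpect (fun t => g t * h t) ^+ 2 <=
  uexpect (fun t => g t ^+ 2) * uexpect (fun t => h t ^+ 2).
Proof.
have : 0 <= uexpect (fun t => uexpect (fun u => (g t * h u - g u * h t) ^+ 2)).
  by apply: uexpect_ge0 => t; apply: uexpect_ge0 => u; apply: sqr_ge0.
set a := uexpect (fun t => g t * h t); set b := uexpect (fun t => g t ^+ 2).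
set c := uexpect (fun t => h t ^+ 2).
have -> : uexpect (fun t => uexpect (fun u => (g t * h u - g u * h t) ^+ 2)) =
    2 * (b * c - a ^+ 2); last by lra.
transitivity (uexpect (fun t => c * g t ^+ 2 + ((- 2 * a) * (g t * h t) + b * h t ^+ 2))).
  apply: eq_uexpect => t.
  transitivity (uexpect (fun u => g t ^+ 2 * h u ^+ 2 +
      ((- 2 * (g t * h t)) * (g u * h u) + h t ^+ 2 * g u ^+ 2))).
    by apply: eq_uexpect => u; ring.
  by rewrite !uexpectD !uexpectZ -/a -/b -/c; ring.
by rewrite !uexpectD !uexpectZ -/a -/b -/c; ring.
Qed.

End Uexpect.

Definition cavg n (f : cube n.+1 -> R) : cube n -> R :=
  fun x => (f (fcons true x) + f (fcons false x)) / 2.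

Definition cdiff n (f : cube n.+1 -> R) : cube n -> R :=
  fun x => (f (fcons true x) - f (fcons false x)) / 2.

Lemma avg_diff n (f : cube n.+1 -> R) b x :
  f (fcons b x) = cavg f x + sgnv b * cdiff f x.
Proof. by rewrite /cavg /cdiff /sgnv; case: b; field. Qed.

Lemma uexpect_avg n (f : cube n.+1 -> R) : uexpect f = uexpect (cavg f).
Proof.
rewrite uexpect_fcons uexpect_bool /cavg -uexpectD mulrC -uexpectZ.
by apply: eq_uexpect => x; rewrite mulrC.
Qed.

Lemma cubeP n (P : cube n.+1 -> Prop) : (forall b x, P (fcons b x)) -> forall x, P x.
Proof. by move=> h x; rewrite -(fcons_behead x); apply: h. Qed.

(* In Fourier terms, [energy m f] is \sum_S m(|S|) \hat f(S)^2 and [mult m f] is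
   \sum_S m(|S|) \hat f(S) \chi_S: splitting off the first coordinate separates
   the sets S avoiding it ([cavg]) from those containing it ([cdiff]). *)
Fixpoint energy n (m : nat -> R) : (cube n -> R) -> R :=
  match n with
  | 0 => fun f => m 0%N * f cnil ^+ 2
  | n'.+1 => fun f => energy m (cavg f) + energy (m \o S) (cdiff f)
  end.

Fixpoint mult n (m : nat -> R) : (cube n -> R) -> cube n -> R :=
  match n with
  | 0 => fun f x => m 0%N * f x
  | n'.+1 => fun f x => mult m (cavg f) (fbehead x)
                + sgnv (x ord0) * mult (m \o S) (cdiff f) (fbehead x)
  end.

Lemma eq_energy n m m' (f f' : cube n -> R) :
  m =1 m' -> f =1 f' -> energy m f = energy m' f'.
Proof.
elim: n => [|n IH] in m m' f f' * => mE fE /=; first by rewrite mE fE.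
by congr (_ + _); apply: IH => [k|x]; rewrite /= ?/cavg ?/cdiff ?mE ?fE.
Qed.

Lemma eq_mult n m m' (f f' : cube n -> R) :
  m =1 m' -> f =1 f' -> mult m f =1 mult m' f'.
Proof.
elim: n => [|n IH] in m m' f f' * => mE fE x /=; first by rewrite mE fE.
by congr (_ + _ * _); apply: IH => [k|y]; rewrite /= ?/cavg ?/cdiff ?mE ?fE.
Qed.

Lemma energy_ge0 n m (f : cube n -> R) : (forall k, 0 <= m k) -> 0 <= energy m f.
Proof.
elim: n => [|n IH] in m f * => m0 /=; first by rewrite mulr_ge0 ?sqr_ge0.
by rewrite addr_ge0 ?IH // => k /=.
Qed.

Lemma le_energy n m m' (f : cube n -> R) : (forall k, m k <= m' k) ->
  energy m f <= energy m' f.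
Proof.
elim: n => [|n IH] in m m' f * => mm /=; first by rewrite ler_wpM2r ?sqr_ge0.
by rewrite lerD ?IH // => k /=.
Qed.

Lemma energyZ n c m (f : cube n -> R) :
  energy (fun k => c * m k) f = c * energy m f.
Proof.
elim: n => [|n IH] in m f * => /=; first by rewrite mulrA.
by rewrite mulrDr -!IH.
Qed.

Lemma energyD n m m' (f : cube n -> R) :
  energy (fun k => m k + m' k) f = energy m f + energy m' f.
Proof.
elim: n => [|n IH] in m m' f * => /=; first by rewrite mulrDl.
by rewrite addrACA -!IH.
Qed.

Lemma mult_fcons n m (f : cube n.+1 -> R) b x :
  mult m f (fcons b x) = mult m (cavg f) x + sgnv b * mult (m \o S) (cdiff f) x.
Proof. by rewrite /= fcons0 fconsK. Qed.

Lemma avg_mult n m (f : cube n.+1 -> R) : cavg (mult m f) =1 mult m (cavg f).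
Proof. by move=> x; rewrite {1}/cavg !mult_fcons /sgnv; field. Qed.

Lemma diff_mult n m (f : cube n.+1 -> R) : cdiff (mult m f) =1 mult (m \o S) (cdiff f).
Proof. by move=> x; rewrite {1}/cdiff !mult_fcons /sgnv; field. Qed.

Lemma energy_mult n w m (f : cube n -> R) :
  energy w (mult m f) = energy (fun k => w k * m k ^+ 2) f.
Proof.
elim: n => [|n IH] in w m f * => /=; first by rewrite exprMn mulrA.
congr (_ + _).
  by rewrite (eq_energy (m' := w) (f' := mult m (cavg f))) ?IH //; apply: avg_mult.
rewrite (eq_energy (m' := w \o S) (f' := mult (m \o S) (cdiff f))) ?IH //.
exact: diff_mult.
Qed.

Lemma energy1 n (f : cube n -> R) : uexpect (fun x => f x ^+ 2) = energy (fun=> 1) f.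
Proof.
elim: n => [|n IH] in f * => /=; first by rewrite (uexpect_ffun0 _ cnil) mul1r.
rewrite -!IH -uexpectD uexpect_avg; apply: eq_uexpect => x.
by rewrite /cavg /cdiff; field.
Qed.

Lemma energy_uexpect n m (f : cube n -> R) :
  uexpect (fun x => mult m f x ^+ 2) = energy (fun k => m k ^+ 2) f.
Proof.
by rewrite energy1 energy_mult; apply: eq_energy => // k; rewrite mul1r.
Qed.

Lemma multZ n c m (f : cube n -> R) x : mult (fun k => c * m k) f x = c * mult m f x.
Proof.
elim: n => [|n IH] in m f x * => /=; first by rewrite mulrA.
rewrite IH mulrDr; congr (_ + _).
by rewrite mulrCA -IH.
Qed.

Lemma multDm n m m' (f : cube n -> R) x :
  mult (fun k => m k + m' k) f x = mult m f x + mult m' f x.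
Proof.
elim: n => [|n IH] in m m' f x * => /=; first by rewrite mulrDl.
by rewrite addrACA -!IH -mulrDr -IH.
Qed.

Lemma multD n c c' m (f g : cube n -> R) x :
  mult m (fun x => c * f x + c' * g x) x = c * mult m f x + c' * mult m g x.
Proof.
elim: n => [|n IH] in m f g x * => /=; first by ring.
have -> : mult m (cavg (fun x => c * f x + c' * g x)) (fbehead x) =
    c * mult m (cavg f) (fbehead x) + c' * mult m (cavg g) (fbehead x).
  by rewrite -IH; apply: eq_mult => // y; rewrite /cavg; field.
have -> : mult (m \o S) (cdiff (fun x => c * f x + c' * g x)) (fbehead x) =
    c * mult (m \o S) (cdiff f) (fbehead x) + c' * mult (m \o S) (cdiff g) (fbehead x).
  by rewrite -IH; apply: eq_mult => // y; rewrite /cdiff; field.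
ring.
Qed.

(* Bonami's inequality: the induction step is (A + B)^4 averaged over the sign
   of B, with Cauchy-Schwarz for the cross term 6 A^2 B^2. *)
Lemma mult_hypercontractive n m (f : cube n -> R) :
  uexpect (fun x => mult m f x ^+ 4) <= energy (fun k => 3 ^+ k * m k ^+ 2) f ^+ 2.
Proof.
elim: n => [|n IH] in m f * => /=.
  by rewrite (uexpect_ffun0 _ cnil) expr0 mul1r -exprMn -exprM.
have := IH m (cavg f); have := IH (m \o S) (cdiff f).
rewrite [energy ((fun k => _) \o S) _](_ : _ =
  3 * energy (fun k => 3 ^+ k * (m \o S) k ^+ 2) (cdiff f)); last first.
  by rewrite -energyZ; apply: eq_energy => // k /=; rewrite exprS mulrA.
set a := energy _ (cavg f); set b := energy _ (cdiff f).
have a0 : 0 <= a by apply: energy_ge0 => k; rewrite mulr_ge0 ?sqr_ge0 ?exprn_ge0.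
have b0 : 0 <= b by apply: energy_ge0 => k; rewrite mulr_ge0 ?sqr_ge0 ?exprn_ge0.
move=> hb ha.
have -> : uexpect (fun x => mult m f x ^+ 4) =
  uexpect (fun x => mult m (cavg f) x ^+ 4) +
  (6 * uexpect (fun x => mult m (cavg f) x ^+ 2 * mult (m \o S) (cdiff f) x ^+ 2) +
  uexpect (fun x => mult (m \o S) (cdiff f) x ^+ 4)).
  rewrite uexpect_avg -uexpectZ -!uexpectD; apply: eq_uexpect => x.
  by rewrite /cavg !mult_fcons /sgnv; field.
suff : uexpect (fun x => mult m (cavg f) x ^+ 2 * mult (m \o S) (cdiff f) x ^+ 2) <= a * b.
  by move=> h; nra.
have AB0 : 0 <= uexpect (fun x => mult m (cavg f) x ^+ 2 * mult (m \o S) (cdiff f) x ^+ 2).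
  by apply: uexpect_ge0 => x; rewrite mulr_ge0 ?sqr_ge0.
rewrite -ler_sqr ?nnegrE; [|exact: AB0|exact: mulr_ge0].
apply: le_trans (uexpect_CauchySchwarz _ _) _; rewrite exprMn.
have E4 (h : cube n -> R) :
    uexpect (fun x => (h x ^+ 2) ^+ 2) = uexpect (fun x => h x ^+ 4).
  by apply: eq_uexpect => x; rewrite -exprM.
by apply: ler_pM; rewrite ?E4 //; apply: uexpect_ge0 => x; by rewrite exprn_even_ge0.
Qed.

(** The mean of G over two uniform points whose coordinates form independent pairs of bits of
    correlation rho. *)
Fixpoint corr n (rho : R) : (cube n -> cube n -> R) -> R :=
  match n with
  | 0 => fun G => G cnil cnil
  | n'.+1 => fun G =>
      (1 + rho) / 4 * (corr rho (fun x y => G (fcons true x) (fcons true y)) +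
                       corr rho (fun x y => G (fcons false x) (fcons false y))) +
      (1 - rho) / 4 * (corr rho (fun x y => G (fcons true x) (fcons false y)) +
                       corr rho (fun x y => G (fcons false x) (fcons true y)))
  end.

Lemma eq_corr n rho (G H : cube n -> cube n -> R) :
  G =2 H -> corr rho G = corr rho H.
Proof.
elim: n => [|n IH] in G H * => GH /=; first by rewrite GH.
by congr (_ * (_ + _) + _ * (_ + _)); apply: IH => x y; rewrite GH.
Qed.

Lemma le_corr n rho (G H : cube n -> cube n -> R) : -1 <= rho <= 1 ->
  (forall x y, G x y <= H x y) -> corr rho G <= corr rho H.
Proof.
move=> /andP[r0 r1]; elim: n => [|n IH] in G H * => GH /=; first exact: GH.
rewrite lerD ?ler_wpM2l ?lerD ?IH // divr_ge0 //; lra.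
Qed.

Lemma corrD n rho (G H : cube n -> cube n -> R) :
  corr rho (fun x y => G x y + H x y) = corr rho G + corr rho H.
Proof. by elim: n => [|n IH] in G H * => //=; rewrite !IH; ring. Qed.

Lemma corrZ n rho c (G : cube n -> cube n -> R) :
  corr rho (fun x y => c * G x y) = c * corr rho G.
Proof. by elim: n => [|n IH] in G * => //=; rewrite !IH; ring. Qed.

Lemma corr_cst n rho c : corr rho (fun _ _ : cube n => c) = c.
Proof. by elim: n => [|n IH] //=; rewrite !IH; field. Qed.

Lemma corr_fst n rho (u : cube n -> R) : corr rho (fun x _ => u x) = uexpect u.
Proof.
elim: n => [|n IH] in u * => /=; first by rewrite (uexpect_ffun0 _ cnil).
by rewrite !IH uexpect_fcons uexpect_bool; field.
Qed.

Lemma corr_snd n rho (u : cube n -> R) : corr rho (fun _ y => u y) = uexpect u.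
Proof.
elim: n => [|n IH] in u * => /=; first by rewrite (uexpect_ffun0 _ cnil).
by rewrite !IH uexpect_fcons uexpect_bool; field.
Qed.

(** Noise stability in Fourier form. On the first coordinate, the mean of (A + s D)(A' + s' D') over
    signs s, s' of correlation rho is A A' + rho D D', so a set of size k picks up rho^k. *)
Lemma corr_energy n rho (f : cube n -> R) :
  corr rho (fun x y => f x * f y) = energy (fun k => rho ^+ k) f.
Proof.
elim: n => [|n IH] in f * => /=; first by rewrite expr0 mul1r.
have -> : energy ((fun k => rho ^+ k) \o S) (cdiff f) =
          rho * energy (fun k => rho ^+ k) (cdiff f).
  by rewrite -energyZ; apply: eq_energy => // k /=; rewrite exprS.
rewrite -!IH /cavg /cdiff.
(* Bilinear expansion, used below with all coefficients equal to 1/2 or -1/2. *)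
have E a b c d : corr rho (fun x y => (a * f (fcons true x) + b * f (fcons false x)) *
       (c * f (fcons true y) + d * f (fcons false y))) =
    a * c * corr rho (fun x y => f (fcons true x) * f (fcons true y)) +
    b * c * corr rho (fun x y => f (fcons false x) * f (fcons true y)) +
    (a * d * corr rho (fun x y => f (fcons true x) * f (fcons false y)) +
    b * d * corr rho (fun x y => f (fcons false x) * f (fcons false y))).
  by rewrite -!corrZ -!corrD; apply: eq_corr => x y; ring.
have -> : corr rho (fun x y => (f (fcons true x) + f (fcons false x)) / 2 *
     ((f (fcons true y) + f (fcons false y)) / 2)) =
   corr rho (fun x y => (2^-1 * f (fcons true x) + 2^-1 * f (fcons false x)) *
     (2^-1 * f (fcons true y) + 2^-1 * f (fcons false y))).
  by apply: eq_corr => x y; field.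
have -> : corr rho (fun x y => (f (fcons true x) - f (fcons false x)) / 2 *
     ((f (fcons true y) - f (fcons false y)) / 2)) =
   corr rho (fun x y => (2^-1 * f (fcons true x) + (- 2^-1) * f (fcons false x)) *
     (2^-1 * f (fcons true y) + (- 2^-1) * f (fcons false y))).
  by apply: eq_corr => x y; field.
by rewrite !E; field.
Qed.

Lemma cube_opp_fcons n b (x : cube n) : cube_opp (fcons b x) = fcons (~~ b) (cube_opp x).
Proof.
apply/ffunP => i; case: (unliftP ord0 i) => [j ->|->]; rewrite ffunE ?fconsS ?fcons0 //.
by rewrite ffunE.
Qed.

(** Flipping every bit of one point negates the correlation. For odd functions this trades the
    correlation -1/3 of the contests for 1/3. *)
Lemma corr_opp n rho (G : cube n -> cube n -> R) :
  corr (- rho) G = corr rho (fun x y => G x (cube_opp y)).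
Proof.
elim: n => [|n IH] in G * => /=; first by congr G; apply/ffunP; case.
rewrite opprK !IH [RHS]addrC; congr (_ * _ + _ * _).
  by congr (_ + _); apply: eq_corr => x y; rewrite cube_opp_fcons.
by congr (_ + _); apply: eq_corr => x y; rewrite cube_opp_fcons.
Qed.

(** Averaging out the coordinates in order turns f into a martingale; this is the sum of the third
    absolute moments of its differences. *)
Fixpoint cubic_error n : (cube n -> R) -> R :=
  match n with
  | 0 => fun=> 0
  | n'.+1 => fun f => uexpect (fun x => `|cdiff f x| ^+ 3) + cubic_error (cavg f)
  end.

Lemma eq_cubic_error n (f g : cube n -> R) :
  f =1 g -> cubic_error f = cubic_error g.
Proof.
elim: n => [|n IH] in f g * => //= fg.
congr (_ + _); first by apply: eq_uexpect => x; rewrite /cdiff !fg.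
by apply: IH => x; rewrite /cavg !fg.
Qed.

(** The mean of J(x + s a, y + t b) over signs s, t of correlation rho: one step of [corr]. *)
Definition four_point rho (J : R -> R -> R) x y a b : R :=
  (1 + rho) / 4 * (J (x + a) (y + b) + J (x - a) (y - b)) +
  (1 - rho) / 4 * (J (x + a) (y - b) + J (x - a) (y + b)).

Definition rho_concave rho (J : R -> R -> R) (C : R) := forall x y a b : R,
  `|x + a| <= 1 -> `|x - a| <= 1 -> `|y + b| <= 1 -> `|y - b| <= 1 ->
  four_point rho J x y a b <= J x y + C * (`|a| ^+ 3 + `|b| ^+ 3).

Lemma avg_norm_le1 n (f : cube n.+1 -> R) :
  (forall x, `|f x| <= 1) -> forall x, `|cavg f x| <= 1.
Proof.
move=> f1 x; have := f1 (fcons true x); have := f1 (fcons false x).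
by rewrite /cavg !ler_norml => /andP[? ?] /andP[? ?]; apply/andP; split; lra.
Qed.

(* Concavity is applied pointwise to one coordinate, the other ones being fixed,
   so that only one function, averaged step by step, has to be followed. *)
Lemma corr_rho_concave n rho J C (f : cube n -> R) : -1 <= rho <= 1 ->
  rho_concave rho J C -> (forall x, `|f x| <= 1) ->
  corr rho (fun x y => J (f x) (f y)) <=
  J (uexpect f) (uexpect f) + 2 * C * cubic_error f.
Proof.
move=> rho1 JC; elim: n => [|n IH] in f * => f1.
  by rewrite /= (uexpect_ffun0 _ cnil) mulr0 addr0.
have := IH _ (avg_norm_le1 f1); rewrite -uexpect_avg => h.
rewrite [cubic_error f]/=.
have -> a b : J (uexpect f) (uexpect f) + 2 * C * (a + b) =
    J (uexpect f) (uexpect f) + 2 * C * b + 2 * C * a by ring.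
apply: le_trans (lerD h (lexx _)); rewrite {h} /=.
(* Both marginals of the correlated pair are uniform, so the cubic error is itself a correlated mean
   and the comparison becomes pointwise. *)
have E : 2 * C * uexpect (fun x => `|cdiff f x| ^+ 3) =
    C * corr rho (fun x y => `|cdiff f x| ^+ 3 + `|cdiff f y| ^+ 3).
  by rewrite corrD (corr_fst rho (fun x => `|cdiff f x| ^+ 3))
             (corr_snd rho (fun x => `|cdiff f x| ^+ 3)); ring.
rewrite E -!corrD -!corrZ -!corrD.
apply: le_corr => // x y.
have := JC (cavg f x) (cavg f y) (cdiff f x) (cdiff f y).
have plus z : cavg f z + cdiff f z = f (fcons true z).
  by rewrite avg_diff /sgnv mul1r.
have minus z : cavg f z - cdiff f z = f (fcons false z).
  by rewrite avg_diff /sgnv mulN1r.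
by rewrite /four_point !plus !minus; apply.
Qed.

(** Influence of a real-valued function, that is, its Fourier weight on the sets containing i;
    [influence_rinf] identifies it with [influence]. *)
Definition rinf n (i : 'I_n) (g : cube n -> R) : R :=
  uexpect (fun x => ((g (set_coord x i true) - g (set_coord x i false)) / 2) ^+ 2).

Lemma set_coord_fcons0 n b c (x : cube n) : set_coord (fcons b x) ord0 c = fcons c x.
Proof.
apply/ffunP => i; rewrite ffunE; case: (unliftP ord0 i) => [j ->|->].
  by rewrite !fconsS.
by rewrite !fcons0 eqxx.
Qed.

Lemma set_coord_fconsS n b c i (x : cube n) :
  set_coord (fcons b x) (lift ord0 i) c = fcons b (set_coord x i c).
Proof.
apply/ffunP => k; rewrite ffunE; case: (unliftP ord0 k) => [j ->|->].
  by rewrite !fconsS ffunE (inj_eq (@lift_inj _ ord0)).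
by rewrite !fcons0 -[ord0 == _]/(false).
Qed.

Lemma eq_rinf n (i : 'I_n) (f g : cube n -> R) : f =1 g -> rinf i f = rinf i g.
Proof. by move=> fg; apply: eq_uexpect => x; rewrite !fg. Qed.

Lemma rinf0 n (g : cube n.+1 -> R) : rinf ord0 g = uexpect (fun x => cdiff g x ^+ 2).
Proof.
rewrite /rinf uexpect_avg; apply: eq_uexpect => x.
by rewrite /cavg !set_coord_fcons0 /cdiff; field.
Qed.

Lemma rinfS n i (g : cube n.+1 -> R) :
  rinf (lift ord0 i) g = rinf i (cavg g) + rinf i (cdiff g).
Proof.
rewrite /rinf uexpect_avg -uexpectD; apply: eq_uexpect => x.
by rewrite /cavg !set_coord_fconsS /cdiff; field.
Qed.

Lemma rinf_ge0 n (i : 'I_n) (g : cube n -> R) : 0 <= rinf i g.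
Proof. by apply: uexpect_ge0 => x; apply: sqr_ge0. Qed.

(** The squared coefficient of a set is counted once for each of its elements. *)
Lemma sum_rinf n (g : cube n -> R) : \sum_i rinf i g = energy (fun k => k%:R) g.
Proof.
elim: n => [|n IH] in g *; first by rewrite big_ord0 /= mul0r.
rewrite big_ord_recl rinf0 energy1 /=.
under eq_bigr do rewrite rinfS.
rewrite big_split /= !IH addrCA -energyD; congr (_ + _).
by apply: eq_energy => // k /=; rewrite -natr1 addrC.
Qed.

(** A multiplier bounded by 1 shrinks every Fourier coefficient, hence the weight on the sets
    containing i. *)
Lemma rinf_mult n i m (f : cube n -> R) : (forall k, `|m k| <= 1) ->
  rinf i (mult m f) <= rinf i f.
Proof.
elim: n i => [[]//|n IH] i in m f * => m1.
case: (unliftP ord0 i) => [j ->|->].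
  rewrite !rinfS (eq_rinf _ (avg_mult m f)) (eq_rinf _ (diff_mult m f)).
  by rewrite lerD // IH // => k /=.
rewrite !rinf0 energy1 (eq_energy (m' := fun=> 1) (f' := mult (m \o S) (cdiff f))) //.
  rewrite energy_mult energy1; apply: le_energy => k /=.
  by rewrite mul1r -real_normK ?num_real // exprn_ile1.
exact: diff_mult.
Qed.

End Discrete.

(** * The noise operator and functions of small influences *)

Section Noise.
Variable R : realType.
Local Notation sgnv := (sgnv R).
Local Notation cube := Defs.cube.

(** Noise is an average. Fixing the first bit leaves the noise of a convex combination of the two
    restrictions of f, with weights (1 + eta) / 2 and (1 - eta) / 2. *)
Lemma noise_norm_le1 n eta (f : cube n -> R) : 0 <= eta <= 1 ->
  (forall x, `|f x| <= 1) -> forall x, `|mult (fun k => eta ^+ k) f x| <= 1.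
Proof.
move=> /andP[eta0 eta1]; elim: n => [|n IH] in f * => f1 x.
  by rewrite /= expr0 mul1r.
move: x; apply: cubeP => b x; rewrite mult_fcons.
have -> : mult ((fun k => eta ^+ k) \o S) (cdiff f) x =
    eta * mult (fun k => eta ^+ k) (cdiff f) x.
  by rewrite -multZ; apply: eq_mult => // k /=; rewrite exprS.
rewrite mulrA -[mult _ (cavg f) x]mul1r -multD; apply: IH => y.
have := f1 (fcons true y); have := f1 (fcons false y).
rewrite /cavg /cdiff /sgnv !ler_norml => /andP[? ?] /andP[? ?].
by case: b; apply/andP; split; nra.
Qed.

(** From |h|^3 <= |h| (2 lo^2 + 2 hi^2): the [hi] term uses |h| <= 1, the [lo] term uses 2 |h| lo^2
    <= c h^2 + lo^4 / c. *)
Lemma cubic_bound n (h lo hi : cube n -> R) c : 0 < c ->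
  (forall x, `|h x| <= 1) -> (forall x, h x = lo x + hi x) ->
  uexpect (fun x => `|h x| ^+ 3) <=
  c * uexpect (fun x => h x ^+ 2) +
  (c^-1 * uexpect (fun x => lo x ^+ 4) + 2 * uexpect (fun x => hi x ^+ 2)).
Proof.
move=> c0 h1 hE; rewrite -!uexpectZ -!uexpectD; apply: le_uexpect => x.
have ci0 : 0 < c^-1 by rewrite invr_gt0.
have cc : c * c^-1 = 1 by rewrite mulfV // gt_eqF.
rewrite -(real_normK (num_real (h x))) (exprM _ 2 2).
have : h x ^+ 2 <= 2 * lo x ^+ 2 + 2 * hi x ^+ 2.
  by have := sqr_ge0 (lo x - hi x); rewrite hE; nra.
rewrite -(real_normK (num_real (h x))).
move: (h1 x) (normr_ge0 (h x)) (sqr_ge0 (hi x)) (sqr_ge0 (lo x)).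
move: `|h x| (lo x ^+ 2) (hi x ^+ 2) => a p q a1 a0 q0 p0 H.
have H1 : a ^+ 3 <= a * (2 * p + 2 * q) by rewrite exprS ler_wpM2l.
have H2 : a * (2 * q) <= 2 * q by rewrite ler_piMl // mulr_ge0.
have H3 : 2 * a * p <= c * a ^+ 2 + c^-1 * p ^+ 2.
  have := mulr_ge0 (ltW ci0) (sqr_ge0 (c * a - p)).
  have -> : c^-1 * (c * a - p) ^+ 2 =
    (c * c^-1) * (c * a ^+ 2) - 2 * (c * c^-1) * (a * p) + c^-1 * p ^+ 2 by ring.
  by rewrite cc; lra.
by lra.
Qed.

(* Degrees below N are controlled by hypercontractivity and small influences,
   the other ones by the decay eta^(2N) of the noise. *)
Lemma cubic_error_noise n eta tau c N (f : cube n -> R) : 0 <= eta <= 1 -> 0 < c ->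
  0 <= tau -> (forall x, `|mult (fun k => eta ^+ k) f x| <= 1) ->
  (forall i, rinf i (mult (fun k => eta ^+ k) f) <= tau) ->
  cubic_error (mult (fun k => eta ^+ k) f) <=
  (c + c^-1 * (9 ^+ N * tau) + 2 * eta ^+ (2 * N)) * energy (fun=> 1) f.
Proof.
move=> /andP[eta0 eta1] c0 tau0; have ci0 : 0 < c^-1 by rewrite invr_gt0.
have eta_le1 k : eta ^+ k <= 1 by rewrite exprn_ile1.
have eta_ge0 k : 0 <= eta ^+ k by rewrite exprn_ge0.
elim: n => [|n IH] in f * => f1 finf.
  rewrite /= mul1r mulr_ge0 ?sqr_ge0 // !addr_ge0 ?mulr_ge0 ?exprn_ge0 ?(ltW c0) ?(ltW ci0) //.
rewrite [cubic_error _]/= [energy (fun=> 1) f]/= mulrDr addrC.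
rewrite (eq_cubic_error (avg_mult _ _)); apply: lerD.
  apply: IH => [x|i].
    by rewrite -avg_mult; exact: avg_norm_le1.
  apply: le_trans (finf (lift ord0 i)).
  by rewrite rinfS (eq_rinf _ (avg_mult _ _)) lerDl rinf_ge0.
set d := cdiff f; set v := energy _ d.
have v0 : 0 <= v by exact: energy_ge0.
(* On sets containing the first coordinate the noise exponent is shifted by one; [mlo] and [mhi] cut
   this multiplier at N. *)
pose m1 k : R := eta ^+ k.+1.
pose mlo k : R := if (k < N)%N then m1 k else 0.
pose mhi k : R := if (k < N)%N then 0 else m1 k.
have f1' x : `|mult m1 d x| <= 1.
  rewrite -[mult m1 d x](diff_mult (fun k => eta ^+ k) f).
  have := f1 (fcons true x); have := f1 (fcons false x).
  by rewrite /cdiff !ler_norml => /andP[? ?] /andP[? ?]; apply/andP; split; lra.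
have -> : uexpect (fun x => `|cdiff (mult (fun k => eta ^+ k) f) x| ^+ 3) =
    uexpect (fun x => `|mult m1 d x| ^+ 3).
  by apply: eq_uexpect => x; rewrite diff_mult.
have hE x : mult m1 d x = mult mlo d x + mult mhi d x.
  rewrite -multDm; apply: eq_mult => // k; rewrite /mlo /mhi.
  by case: ifP => _; rewrite ?addr0 ?add0r.
apply: le_trans (cubic_bound c0 f1' hE) _.
pose w := energy (fun k => m1 k ^+ 2) d.
have wv : w <= v by apply: le_energy => k; rewrite -exprM.
have w0 : 0 <= w by apply: energy_ge0 => k; exact: sqr_ge0.
have wtau : w <= tau.
  rewrite /w -energy_uexpect; have := finf ord0; rewrite rinf0; apply: le_trans.
  by apply: le_uexpect => x; rewrite diff_mult.
have H1 : uexpect (fun x => mult m1 d x ^+ 2) <= v by rewrite energy_uexpect.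
(* Bonami's inequality gives (3^N w)^2. One factor w is bounded by tau and the other by v, because
   the v of all the coordinates add up to at most the energy of f. *)
have H2 : uexpect (fun x => mult mlo d x ^+ 4) <= 9 ^+ N * tau * v.
  apply: le_trans (mult_hypercontractive _ _) _.
  have h : energy (fun k => 3 ^+ k * mlo k ^+ 2) d <= 3 ^+ N * w.
    rewrite -energyZ; apply: le_energy => k; rewrite /mlo.
    case: ifP => kN; last by rewrite expr0n mulr0 mulr_ge0 ?sqr_ge0 ?exprn_ge0.
    by rewrite ler_wpM2r ?sqr_ge0 // ler_eXn2l // ?ltr1n // ltnW.
  have h0 : 0 <= energy (fun k => 3 ^+ k * mlo k ^+ 2) d.
    by apply: energy_ge0 => k; rewrite mulr_ge0 ?sqr_ge0 ?exprn_ge0.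
  apply: (@le_trans _ _ ((3 ^+ N * w) ^+ 2)).
    by rewrite ler_sqr ?nnegrE // mulr_ge0 ?exprn_ge0.
  have -> : (9 : R) = 3 ^+ 2 by rewrite expr2 -natrM.
  rewrite exprMn -!exprM mulnC -mulrA ler_wpM2l ?exprn_ge0 //.
  by rewrite expr2 ler_pM.
have H3 : uexpect (fun x => mult mhi d x ^+ 2) <= eta ^+ (2 * N) * v.
  rewrite energy_uexpect -energyZ; apply: le_energy => k; rewrite /mhi mulr1.
  case: ifP => kN; first by rewrite expr0n.
  rewrite /m1 -exprM; apply: ler_wiXn2l; rewrite ?eta0 ?eta1 //.
  by rewrite mulnC leq_mul2r /= leqW // leqNgt kN.
have := ler_wpM2l (ltW ci0) H2; have := ler_wpM2l (ltW c0) H1.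
move: (c^-1) => ci; rewrite !mulrDl; lra.
Qed.

(** k q^k is at most 1 + q + ... + q^(k-1), and this sum times 1 - q is 1 - q^k. *)
Lemma natr_pow_le (q : R) k : 0 <= q -> q < 1 -> k%:R * q ^+ k * (1 - q) <= 1.
Proof.
move=> q0 q1.
suff : k%:R * q ^+ k * (1 - q) <= 1 - q ^+ k.
  by move/le_trans; apply; rewrite lerBlDr lerDl exprn_ge0.
elim: k => [|k IH]; first by rewrite !mul0r expr0 subrr.
have qk : q ^+ k <= 1 by rewrite exprn_ile1 // ltW.
have h := ler_wpM2l q0 IH; rewrite -natr1 !exprS.
have := exprn_ge0 k q0; move: (q ^+ k) (k%:R : R) h qk => p m h qk p0.
have : 0 <= (1 - q) * (1 - q * p) by rewrite mulr_ge0 ?subr_ge0 ?(ltW q1) // mulr_ile1 // ltW.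
by nra.
Qed.

Lemma energy_le1 n (f : cube n -> R) : (forall x, `|f x| <= 1) ->
  energy (fun=> 1) f <= 1.
Proof.
move=> f1; rewrite -energy1 -[leRHS](uexpect_cst ([ffun=> true] : cube n) 1).
by apply: le_uexpect => x; rewrite -real_normK ?num_real // exprn_ile1.
Qed.

(** The loss at degree k is rho^k (1 - eta^(2k)) <= 2 k (1 - eta) rho^k, which [natr_pow_le] bounds
    uniformly in k. *)
Lemma noise_stability_cont n rho eta (f : cube n -> R) :
  0 <= rho -> rho < 1 -> 0 <= eta <= 1 -> (forall x, `|f x| <= 1) ->
  energy (fun k => rho ^+ k) f <=
  energy (fun k => rho ^+ k) (mult (fun k => eta ^+ k) f) + 2 * (1 - eta) / (1 - rho).
Proof.
move=> r0 r1 /andP[eta0 eta1] f1.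
have E1 := energy_le1 f1.
have c0 : 0 <= 2 * (1 - eta) / (1 - rho).
  by rewrite divr_ge0 ?mulr_ge0 ?subr_ge0 // ltW.
rewrite energy_mult; apply: le_trans (lerD (lexx _) (ler_piMr c0 E1)).
rewrite -energyZ -energyD; apply: le_energy => k; rewrite mulr1.
have B : 1 - (eta ^+ k) ^+ 2 <= 2 * k%:R * (1 - eta).
  rewrite -exprM; elim: k => [|k IH]; first by rewrite mul0n expr0 subrr mulr0 mul0r.
  have p1 : eta ^+ (k * 2) <= 1 by rewrite exprn_ile1.
  have p0 : 0 <= eta ^+ (k * 2) by rewrite exprn_ge0.
  have h : 0 <= (1 - eta) * (2 - eta ^+ (k * 2) * (1 + eta)).
    by rewrite mulr_ge0 ?subr_ge0 // -[leRHS]mul1r ler_pM // ?addr_ge0 //; lra.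
  by rewrite mulSn !exprS -natr1; move: h IH; move: (eta ^+ (k * 2)) => p; lra.
have H := natr_pow_le k r0 r1.
have rk0 := exprn_ge0 k r0; have := ler_wpM2l rk0 B.
suff : 2 * (1 - eta) * (k%:R * rho ^+ k) <= 2 * (1 - eta) / (1 - rho) by lra.
rewrite ler_wpM2l ?mulr_ge0 ?subr_ge0 //.
by rewrite -[leRHS]mul1r ler_pdivlMr ?subr_gt0.
Qed.

(* The parameters kappa and J stand for a function that dominates the product
   (1/2 + kappa u)(1/2 + kappa v): for kappa close to 1/2 this is close to the
   product of the {0,1}-valued versions of u and v. *)
Lemma low_influence_stability rho kappa eta tau c N C J n (f : cube n -> R) :
  0 <= rho -> rho < 1 -> 0 <= eta <= 1 -> 0 < c -> 0 <= tau -> 0 <= C ->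
  rho_concave rho J C ->
  (forall u v, `|u| <= 1 -> `|v| <= 1 ->
     (1 / 2 + kappa * u) * (1 / 2 + kappa * v) <= J u v) ->
  (forall x, `|f x| <= 1) -> uexpect f = 0 ->
  (forall i, rinf i (mult (fun k => eta ^+ k) f) <= tau) ->
  kappa ^+ 2 * energy (fun k => rho ^+ k) (mult (fun k => eta ^+ k) f) <=
  J 0 0 - 1 / 4 + 2 * C * (c + c^-1 * (9 ^+ N * tau) + 2 * eta ^+ (2 * N)).
Proof.
move=> r0 r1 eta01 c0 tau0 C0 JC JM f1 f0 finf.
set g := mult _ f in finf *.
have g1 : forall x, `|g x| <= 1 by exact: noise_norm_le1.
(* Noise keeps the coefficient of the empty set, since eta^0 = 1. *)
have g0 : uexpect g = 0.
  rewrite -{}f0 /g; elim: n f {f1 finf g g1} => [|n IH] f.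
    by rewrite !(uexpect_ffun0 _ cnil) /= expr0 mul1r.
  rewrite uexpect_avg [RHS]uexpect_avg; apply: etrans (IH (cavg f)).
  by apply: eq_uexpect => x; rewrite avg_mult.
have E1 := energy_le1 f1.
have rho1 : -1 <= rho <= 1 by apply/andP; split; lra.
have := corr_rho_concave rho1 JC g1; rewrite g0.
have : corr rho (fun x y => (1 / 2 + kappa * g x) * (1 / 2 + kappa * g y)) <=
    corr rho (fun x y => J (g x) (g y)) by apply: le_corr => // x y; exact: JM.
(* The linear terms vanish because g has mean 0; only 1/4 and the stability of g remain. *)
have -> : corr rho (fun x y => (1 / 2 + kappa * g x) * (1 / 2 + kappa * g y)) =
   corr rho (fun x y => (1 / 4 + kappa / 2 * g x) + (kappa / 2 * g y + kappa ^+ 2 * (g x * g y))).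
  by apply: eq_corr => x y; field.
rewrite !corrD (corrZ _ _ (fun x y => g x * g y)) corr_energy corr_cst.
rewrite (corr_fst rho (fun x => kappa / 2 * g x)) (corr_snd rho (fun x => kappa / 2 * g x)).
rewrite uexpectZ g0 => h1 h2.
have h3 := cubic_error_noise N eta01 c0 tau0 g1 finf.
have eta0 : 0 <= eta by case/andP: eta01.
have K0 : 0 <= c + c^-1 * (9 ^+ N * tau) + 2 * eta ^+ (2 * N).
  by rewrite !addr_ge0 ?mulr_ge0 ?invr_ge0 ?exprn_ge0 // ltW.
have := ler_wpM2l C0 (le_trans h3 (ler_piMr K0 E1)).
by move: h1 h2; rewrite -/g; lra.
Qed.

End Noise.

(** * Symmetries of the cube and ranking profiles *)

Section Symmetry.
Variable R : realType.

Definition permute n (s : 'S_n) (x : cube n) : cube n := [ffun k => x (s k)].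

Lemma permute_bij n (s : 'S_n) : bijective (permute s).
Proof.
exists (permute s^-1) => x; apply/ffunP => i; rewrite !ffunE; congr (x _).
  by rewrite permKV.
by rewrite permK.
Qed.

Definition flip_weight (eta : R) (b b' : bool) : R :=
  if b == b' then (1 + eta) / 2 else (1 - eta) / 2.

(** As a product of identical one-bit kernels, the noise operator visibly commutes with permutations
    of the coordinates. *)
Lemma mult_kernel n eta (f : cube n -> R) x :
  mult (fun k => eta ^+ k) f x =
  \sum_(y : cube n) (\prod_(i < n) flip_weight eta (x i) (y i)) * f y.
Proof.
elim: n => [|n IH] in f x *.
  rewrite (sum_ffun0 _ x) big_ord0 /= expr0; congr (_ * f _).
move: x; apply: cubeP => b x; rewrite mult_fcons.
have -> : mult ((fun k => eta ^+ k) \o S) (cdiff f) x =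
    eta * mult (fun k => eta ^+ k) (cdiff f) x.
  by rewrite -multZ; apply: eq_mult => // k /=; rewrite exprS.
rewrite !IH sum_fcons big_bool /= mulrA mulr_sumr -!big_split /=.
apply: eq_bigr => y _; rewrite !big_ord_recl !fcons0.
have E c : \prod_(i < n) flip_weight eta (fcons b x (lift ord0 i)) (fcons c y (lift ord0 i)) =
  \prod_(i < n) flip_weight eta (x i) (y i).
  by apply: eq_bigr => i _; rewrite !fconsS.
rewrite !E {E}; move: (\prod_(i < n) _) => p.
by rewrite /cavg /cdiff /flip_weight /sgnv; case: b => /=; field.
Qed.

Lemma noise_permute n eta (s : 'S_n) (f : cube n -> R) :
  (forall x, f x = f (permute s x)) ->
  forall x, mult (fun k => eta ^+ k) f x = mult (fun k => eta ^+ k) f (permute s x).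
Proof.
move=> fs x; rewrite !mult_kernel [RHS](reindex (permute s)) /=; last first.
  exact: onW_bij (permute_bij s).
apply: eq_bigr => y _; rewrite -fs; congr (_ * _).
rewrite (reindex_inj (@perm_inj _ s)) /=.
by apply: eq_bigr => i _; rewrite !ffunE.
Qed.

Lemma rinf_permute n (s : 'S_n) i j (g : cube n -> R) :
  (forall x, g x = g (permute s x)) -> s i = j -> rinf i g = rinf j g.
Proof.
move=> gs sij; rewrite /rinf /uexpect (reindex (permute s)) /=; last first.
  exact: onW_bij (permute_bij s).
congr (_ / _); apply: eq_bigr => x _; rewrite [in RHS]gs (gs (set_coord x j false)).
have E b : set_coord (permute s x) i b = permute s (set_coord x j b).
  apply/ffunP => k; rewrite !ffunE -sij (inj_eq perm_inj).
  by case: eqP.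
by rewrite !E.
Qed.

(** All influences of the noisy function are equal by symmetry, so n times one of them is the total
    influence. *)
Lemma rinf_noise_symmetric n eta (f : cube n -> R) i :
  (forall i j : 'I_n, (i < j)%N ->
     exists2 s : 'S_n, s i = j & forall x, f x = f (permute s x)) ->
  n%:R * rinf i (mult (fun k => eta ^+ k) f) =
  energy (fun k => k%:R * (eta ^+ k) ^+ 2) f.
Proof.
move=> tr; set g := mult _ f.
have E (j : 'I_n) : rinf j g = rinf i g.
  have lt_case (k l : 'I_n) : (k < l)%N -> rinf k g = rinf l g.
    move=> /tr[s sk fs]; apply: (@rinf_permute _ s) => //.
    exact: noise_permute.
  case: (ltngtP j i) => [/lt_case //|/lt_case //|/val_inj -> //].
rewrite -energy_mult -sum_rinf (eq_bigr (fun=> rinf i g)) //.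
by rewrite sumr_const card_ord mulr_natl.
Qed.

Lemma influence_rinf n i (f : bfun n) :
  influence R i f = rinf i (fun x => sgnv R (f x)).
Proof.
by apply: eq_uexpect => x; rewrite /uvariance !uexpect_bool; field.
Qed.

End Symmetry.

(** * Random rankings and the probability of a rational outcome *)

Section Profiles.
Variable R : realType.

(** Two comparisons that agree for 2 of the 6 rankings and differ for 4, evenly in both cases:
    uniform signs of correlation -1/3. *)
Definition pair_law (al be : ranking -> bool) := forall H : bool -> bool -> R,
  \sum_r H (al r) (be r) =
  H true true + H false false + 2 * (H true false + H false true).

Lemma uexpect_profile n al be (G : cube n -> cube n -> R) : pair_law al be ->
  uexpect (fun p : profile n => G [ffun v => al (p v)] [ffun v => be (p v)]) =
  corr (- (1 / 3)) G.
Proof.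
move=> law; elim: n => [|n IH] in G *.
  rewrite (uexpect_ffun0 _ [ffun=> 1%g]) /=.
  by congr G; apply/ffunP; case.
rewrite uexpect_fcons /uexpect.
pose H b c := corr (- (1 / 3)) (fun x y => G (fcons b x) (fcons c y)).
rewrite (eq_bigr (fun r => H (al r) (be r))); last first.
  move=> r _; rewrite /H -IH; apply: eq_uexpect => p.
  have E (ga : ranking -> bool) :
      [ffun v => ga (fcons r p v)] = fcons (ga r) [ffun v => ga (p v)].
    apply/ffunP => i; case: (unliftP ord0 i) => [j ->|->].
      by rewrite ffunE !fconsS ffunE.
    by rewrite ffunE !fcons0.
  by rewrite !E.
have -> : #|{: ranking}|%:R = 6 :> R by rewrite card_Sn.
by rewrite law /H /=; field.
Qed.

Definition ab (r : ranking) := prefers r candA candB.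
Definition bc (r : ranking) := prefers r candB candC.
Definition ca (r : ranking) := prefers r candC candA.

(** Renaming the candidates cyclically permutes [ab], [bc] and [ca], so that only one of the three
    joint laws has to be counted. *)
Definition ranking_rot : 'S_3 := perm (@addrI _ (1 : 'I_3)).

Lemma ranking_rotE : [/\ ranking_rot candA = candB, ranking_rot candB = candC
  & ranking_rot candC = candA].
Proof. by split; rewrite permE; apply: val_inj. Qed.

Lemma ab_rot r : ab (ranking_rot * r)%g = bc r.
Proof. by case: ranking_rotE => a b c; rewrite /ab /bc /prefers !permM a b. Qed.

Lemma bc_rot r : bc (ranking_rot * r)%g = ca r.
Proof. by case: ranking_rotE => a b c; rewrite /ca /bc /prefers !permM c b. Qed.

Lemma ca_rot r : ca (ranking_rot * r)%g = ab r.
Proof. by case: ranking_rotE => a b c; rewrite /ca /ab /prefers !permM c a. Qed.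

Definition ranking_rev : 'S_3 := perm (@rev_ord_inj 3).

Lemma prefers_rev (r : ranking) (i j : 'I_3) : i != j ->
  prefers (r * ranking_rev)%g i j = ~~ prefers r i j.
Proof.
move=> ij; rewrite /prefers !permM !permE /= -leqNgt.
have : r i != r j by rewrite (inj_eq perm_inj).
rewrite -val_eqE /=; have := ltn_ord (r i); have := ltn_ord (r j).
by case: (r i) (r j) => [[|[|[|]]] //= ?] [[|[|[|]]] //= ?].
Qed.

(** Only the identity ranking puts A before B before C. Reversing positions negates both
    comparisons, so each agreeing cell has size 1 and the two other cells share the remaining 4
    equally. *)
Lemma pair_law_ab_bc : pair_law ab bc.
Proof.
move=> H.
pose N u v : nat := #|[set r : ranking | (ab r == u) && (bc r == v)]|.
have E : \sum_r H (ab r) (bc r) =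
  (N true true)%:R * H true true + (N true false)%:R * H true false +
  ((N false true)%:R * H false true + (N false false)%:R * H false false).
  have cnt u v : (N u v)%:R * H u v =
    \sum_(r : ranking) (if (ab r == u) && (bc r == v) then H u v else 0).
    rewrite -big_mkcond /= /N sumr_const mulr_natl; congr (_ *+ _).
    by apply: eq_card => r; rewrite inE.
  rewrite !cnt -!big_split /=; apply: eq_bigr => r _.
  by case: (ab r) (bc r) => [] []; rewrite /= ?addr0 ?add0r.
have total : (N true true + N true false + (N false true + N false false))%N = 6%N.
  transitivity (\sum_(r : ranking) 1)%N; last by rewrite sum1_card card_Sn.
  have cnt u v : N u v = (\sum_(r : ranking) ((ab r == u) && (bc r == v)))%N.
    rewrite /N -sum1_card big_mkcond /=; apply: eq_bigr => r _; rewrite inE.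
    by case: andb.
  rewrite !cnt -!big_split /=; apply: eq_bigr => r _.
  by case: (ab r) (bc r) => [] [].
have rev u v : N u v = N (~~ u) (~~ v).
  rewrite /N -(card_imset _ (mulIg ranking_rev)); apply: eq_card => r.
  have -> : r = ((r * ranking_rev^-1) * ranking_rev)%g by rewrite mulgKV.
  apply: etrans (mem_imset _ _ (mulIg ranking_rev)) _; rewrite !inE.
  rewrite /ab /bc !prefers_rev // !(inj_eq negb_inj) //.
have one : N true true = 1%N.
  rewrite /N -[RHS](cards1 (1%g : ranking)); apply: eq_card => r.
  rewrite !inE !eqb_id; apply/andP/eqP => [[h1 h2]|->]; last by rewrite /ab /bc /prefers !perm1.
  have r2 := ltn_ord (r candC); rewrite /ab /bc /prefers in h1 h2.
  have e2 : r candC = 2%N :> nat by lia.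
  have e1 : r candB = 1%N :> nat by lia.
  have e0 : r candA = 0%N :> nat by lia.
  apply/permP => i; rewrite perm1; apply: val_inj.
  have [->|[->|->]] : i = candA \/ i = candB \/ i = candC; rewrite ?e0 ?e1 ?e2 //.
  case: i => [[|[|[|//]]] ?]; [left|right;left|right;right]; exact: val_inj.
have ff : N false false = 1%N by rewrite rev.
have ft : N false true = N true false by rewrite rev.
have tf : N true false = 2%N by move: total; rewrite one ff ft; lia.
by rewrite E one ff ft tf; ring.
Qed.

Lemma pair_law_bc_ca : pair_law bc ca.
Proof.
move=> H; rewrite -pair_law_ab_bc [RHS](reindex_inj (mulgI ranking_rot)) /=.
by apply: eq_bigr => r _; rewrite ab_rot bc_rot.
Qed.

Lemma pair_law_ca_ab : pair_law ca ab.
Proof.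
move=> H; rewrite -pair_law_bc_ca [RHS](reindex_inj (mulgI ranking_rot)) /=.
by apply: eq_bigr => r _; rewrite ca_rot bc_rot.
Qed.

(** For signs u, v, w the indicator that they are not all equal is 3/4 - (uv + vw + wu)/4. Each
    product has mean minus the stability at 1/3, since f is odd and its two arguments have
    correlation -1/3. *)
Lemma rational_prob_energy n (f : bfun n) : odd_bfun f ->
  rational_prob R f =
  3 / 4 + 3 / 4 * energy (fun k => (1 / 3) ^+ k) (fun x => sgnv R (f x)).
Proof.
move=> fodd; set F := fun x => sgnv R (f x).
have stab al be : pair_law al be ->
   uexpect (fun p : profile n => F [ffun v => al (p v)] * F [ffun v => be (p v)]) =
   - energy (fun k => (1 / 3) ^+ k) F.
  move=> law; rewrite (uexpect_profile (fun x y => F x * F y) law) corr_opp -corr_energy.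
  rewrite -mulN1r -corrZ; apply: eq_corr => x y.
  by rewrite /F fodd /sgnv; case: (f y) => /=; ring.
have E : rational_prob R f = uexpect (fun p : profile n =>
    3 / 4 + (- (1 / 4) * (F [ffun v => ab (p v)] * F [ffun v => bc (p v)]) +
    (- (1 / 4) * (F [ffun v => bc (p v)] * F [ffun v => ca (p v)]) +
    (- (1 / 4) * (F [ffun v => ca (p v)] * F [ffun v => ab (p v)]))))).
  rewrite /rational_prob /uprob /uexpect -sum1_card natr_sum big_mkcond /=.
  congr (_ / _); apply: eq_bigr => p _.
  rewrite [p \in _](_ : _ = ~~ cyclic_outcome f p) // /cyclic_outcome /contest /F /ab /bc /ca /sgnv.
  by case: (f _); case: (f _); case: (f _) => /=; field.
have C : uexpect (fun _ : profile n => 3 / 4) = 3 / 4 :> R.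
  exact: (uexpect_cst [ffun=> 1%g]).
rewrite E uexpectD C !uexpectD !uexpectZ !stab; first by field.
- exact: pair_law_ca_ab.
- exact: pair_law_bc_ca.
- exact: pair_law_ab_bc.
Qed.

End Profiles.

Local Open Scope classical_set_scope.
Local Open Scope ring_scope.

(** * The Gaussian orthant function *)

Section RealDerivatives.
Variable R : realType.
Implicit Types (f df : R -> R) (a b x : R).

Lemma is_derive_MVT f df a b : a <= b ->
  (forall x, a <= x <= b -> is_derive x 1 f (df x)) ->
  exists2 c, a <= c <= b & f b - f a = df c * (b - a).
Proof.
move=> ab D.
have [||c] := @MVT_segment R f df a b ab.
- move=> x; rewrite in_itv /= => /andP[xa xb]; apply: D.
  by rewrite (ltW xa) (ltW xb).
- apply: derivable_within_continuous => x; rewrite in_itv /= => xab.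
  by have [] := D x xab.
by rewrite in_itv /= => cab E; exists c.
Qed.

Lemma is_derive_ge0_le f df a b : a <= b ->
  (forall x, a <= x <= b -> is_derive x 1 f (df x)) ->
  (forall x, a <= x <= b -> 0 <= df x) -> f a <= f b.
Proof.
move=> ab D df0; have [c cab E] := is_derive_MVT ab D.
by rewrite -subr_ge0 E mulr_ge0 ?df0 // subr_ge0.
Qed.

End RealDerivatives.

Section GaussianCdf.
Variable R : realType.
Implicit Types x y : R.
Local Notation mu := (@lebesgue_measure R).

(** Distribution function of the centred Gaussian of variance 1/2, of density exp(-t^2) / sqrt pi,
    anchored at its value 1/2 in 0. *)
Definition gcdf x : R := 1 / 2 +
  (\int[mu]_(t in `]-oo, x]) gauss_fun t -
   \int[mu]_(t in `]-oo, 0]) gauss_fun t) / Num.sqrt pi.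

Lemma gcdf0 : gcdf 0 = 1 / 2.
Proof. by rewrite /gcdf subrr mul0r addr0. Qed.

Global Instance is_derive_gcdf x : is_derive x 1 gcdf (gauss_fun x / Num.sqrt pi).
Proof.
rewrite /gcdf.
have : is_derive x 1 (fun x : R => \int[mu]_(t in `]-oo, x]) gauss_fun t) (gauss_fun x).
  have xx1 : x < x + 1 by rewrite ltrDl.
  have := @continuous_FTC1 R (@gauss_fun R) -oo%O x (x + 1) xx1.
  case=> [|||D E]. 
  - apply: integrableS (@integrableT_gauss R) => //.
  - by rewrite /= ltNyr.
  - exact: continuous_gauss_fun.
  by apply: DeriveDef; [exact: D|rewrite -derive1E; exact: E].
move=> D; apply: is_derive_eq; rewrite /GRing.scale /=; ring.
Qed.

Lemma sqrtpi_gt0 : 0 < Num.sqrt pi :> R.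
Proof. by rewrite sqrtr_gt0 pi_gt0. Qed.

Lemma gauss_fun_gt0 x : 0 < gauss_fun x.
Proof. exact: expR_gt0. Qed.

Lemma gcdf_lt x y : x < y -> gcdf x < gcdf y.
Proof.
move=> xy; have [c _ E] := is_derive_MVT (ltW xy) (df := fun z => gauss_fun z / Num.sqrt pi)
  (f := gcdf) (fun z _ => is_derive_gcdf z).
by rewrite -subr_gt0 E mulr_gt0 ?subr_gt0 // divr_gt0 ?gauss_fun_gt0 ?sqrtpi_gt0.
Qed.

Lemma gcdf_inj : injective gcdf.
Proof.
by move=> x y; case: (ltgtP x y) => // /gcdf_lt + E; rewrite E ltxx.
Qed.

Lemma gcdfN x : gcdf (- x) = 1 - gcdf x.
Proof.
suff E : forall y, gcdf y + gcdf (- y) = gcdf 0 + gcdf (- 0).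
  by have := E x; rewrite oppr0 gcdf0; lra.
move=> y; apply: (@is_derive_0_is_cst _ (fun y => gcdf y + gcdf (- y))) => z.
have D : is_derive z 1 (fun y => gcdf (- y)) (gauss_fun (- z) / Num.sqrt pi * - 1).
  exact: (@is_derive1_comp _ gcdf -%R).
apply: is_derive_eq.
by rewrite /gauss_fun sqrrN; ring.
Qed.

Lemma gcdf_integral x : 0 <= x ->
  gcdf x = 1 / 2 + gauss_integral_proof.integral0_gauss x / Num.sqrt pi.
Proof.
rewrite le_eqVlt => /orP[/eqP<-|x0].
  by rewrite gcdf0 /gauss_integral_proof.integral0_gauss set_itv1 Rintegral_set1 mul0r addr0.
rewrite /gauss_integral_proof.integral0_gauss /Rintegral.
rewrite (@continuous_FTC2 _ _ (fun x => (gcdf x - 1/2) * Num.sqrt pi)) //=.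
- rewrite gcdf0 subrr mul0r subr0 mulfK ?gt_eqF ?sqrtpi_gt0 //.
  by rewrite addrC subrK.
- by apply: continuous_subspaceT; exact: continuous_gauss_fun.
- have D z : derivable (fun x => (gcdf x - 1/2) * Num.sqrt pi) z 1.
    by apply: derivableM => //; apply: derivableB => //; have [] := is_derive_gcdf z.
  have C z : {for z, continuous (fun x => (gcdf x - 1/2) * Num.sqrt pi)}.
    by apply/differentiable_continuous/derivable1_diffP.
  split => [z _||].
  + exact: D.
  + exact: cvg_at_right_filter (C 0).
  + exact: cvg_at_left_filter (C x).
move=> z _; rewrite derive1E.
have := is_derive_gcdf z => Dz.
have /@derive_val -> : is_derive z 1 (fun x => (gcdf x - 1/2) * Num.sqrt pi) (gauss_fun z).
  apply: is_derive_eq; rewrite /GRing.scale /= !subr0 !mulr0 ?add0r ?addr0.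
  by rewrite mulrC divfK // gt_eqF ?sqrtpi_gt0.
by [].
Qed.

Lemma gcdf_surj y : 0 < y < 1 -> exists x, gcdf x = y.
Proof.
have half z : 1 / 2 <= z < 1 -> exists x, gcdf x = z.
  move=> /andP[z0 z1].
  have /cvgrPdist_lt := @gauss_integral_proof.cvg_integral0_gauss_sqr R.
  (* With I the integral of [gauss_fun] over [0, X], z <= gcdf X follows from (pi/4) (2z - 1)^2 <=
     I^2. The tolerance below is the gap between that left side and the limit pi/4 of I^2. *)
  have sp : 0 < 1 - (2 * z - 1) ^+ 2.
    have -> : 1 - (2 * z - 1) ^+ 2 = (4 * z) * (1 - z) by ring.
    by rewrite mulr_gt0 //; lra.
  have e0 : 0 < pi / 4 * (1 - (2 * z - 1) ^+ 2) :> R.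
    by rewrite mulr_gt0 // divr_gt0 ?pi_gt0.
  move=> /(_ _ e0)[M [_ HM]].
  pose X := Num.max M 0 + 1.
  have XM : M < X by rewrite /X ltr_pwDr // le_max lexx.
  have X0 : 0 <= X by rewrite /X addr_ge0 // le_max lexx orbT.
  have zX : z <= gcdf X.
    rewrite gcdf_integral //.
    have := HM _ XM; set I := gauss_integral_proof.integral0_gauss X.
    have I0 : 0 <= I by apply: gauss_integral_proof.integral0_gauss_ge0.
    move=> /(le_lt_trans (ler_norm _)) h.
    have : (2 * z - 1) ^+ 2 <= (2 * (I / Num.sqrt pi)) ^+ 2.
      rewrite exprMn expr_div_n sqr_sqrtr ?pi_ge0 //.
      rewrite mulrA ler_pdivlMr ?pi_gt0 //; lra.
    rewrite ler_sqr ?nnegrE; last 2 first.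
    - by lra.
    - by rewrite mulr_ge0 // divr_ge0 // ltW // sqrtpi_gt0.
    by lra.
  have [||x _ E] := @IVT R gcdf 0 X z X0.
  - apply: derivable_within_continuous => t _; by have [] := is_derive_gcdf t.
  - by rewrite ge_min le_max gcdf0 z0 zX orbT.
  by exists x.
move=> /andP[y0 y1]; case: (lerP (1 / 2) y) => h; first by apply: half; rewrite h y1.
have [|x E] := half (1 - y); first by apply/andP; split; lra.
by exists (- x); rewrite gcdfN E; lra.
Qed.

(** Quantile function; 0 is the default where y is not a value of [gcdf]. *)
Definition gquant y : R := xget 0 [set x | gcdf x = y].

Lemma gcdfK y : 0 < y < 1 -> gcdf (gquant y) = y.
Proof. by move=> /gcdf_surj[x E]; rewrite /gquant; case: xgetP => // /(_ x) []. Qed.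

Lemma gquantK : cancel gcdf gquant.
Proof. by move=> x; apply: gcdf_inj; rewrite /gquant; case: xgetP => // /(_ x) []. Qed.

Lemma gquant_half : gquant (1 / 2) = 0.
Proof. by rewrite -gcdf0 gquantK. Qed.

Lemma is_derive_gquant y : 0 < y < 1 ->
  is_derive y 1 gquant (Num.sqrt pi / gauss_fun (gquant y)).
Proof.
move=> y01; rewrite -{1}(gcdfK y01) -[_ / _]invf_div.
apply: is_derive_inverse.
- by near=> x; apply: gquantK.
- near=> x; apply/differentiable_continuous/derivable1_diffP.
  by have [] := is_derive_gcdf x.
- by rewrite mulf_neq0 ?invr_eq0 // gt_eqF ?gauss_fun_gt0 ?sqrtpi_gt0.
Unshelve. all: by end_near. Qed.

End GaussianCdf.

(** * Integrals over a segment depending on a parameter *)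

Section ParametricIntegral.
Variable R : realType.
Local Notation mu := (@lebesgue_measure R).

Lemma is_derive_continuous_segment (f df : R -> R) (a b : R) :
  (forall t : R, a <= t <= b -> is_derive t 1 f (df t)) -> {within `[a, b], continuous f}.
Proof.
move=> D; apply: derivable_within_continuous => t; rewrite in_itv /= => tab.
by have [] := D t tab.
Qed.

Lemma segment_integrable (f : R -> R) (a b : R) : {within `[a, b], continuous f} ->
  mu.-integrable `[a, b] (EFin \o f).
Proof. by move=> cf; apply: continuous_compact_integrable => //; exact: segment_compact. Qed.

Lemma is_derive_Rintegral (f df : R -> R -> R) (a b x M : R) :
  (forall y, {within `[a, b], continuous (f y)}) ->
  (forall y t : R, a <= t <= b -> is_derive y 1 (f^~ t) (df y t)) ->
  (forall y t : R, x - 1 < y < x + 1 -> a <= t <= b -> `|df y t| <= M) ->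
  is_derive x 1 (fun y => \int[mu]_(t in `[a, b]) f y t)
    (\int[mu]_(t in `[a, b]) df x t).
Proof.
move=> cf D dfM.
have Ix : `]x - 1, x + 1[%classic x by rewrite /= in_itv /=; apply/andP; split; lra.
(* M carries no sign assumption, so its positive part serves as the dominating constant. *)
have M0 (y : R) : 0 <= Num.max M 0 by rewrite le_max lexx orbT.
have dE y t : a <= t <= b -> partial1of2 f y t = df y t.
  by move=> tab; rewrite partial1of2E; have [_ ->] := D y t tab.
have intf y : `]x - 1, x + 1[%classic y -> mu.-integrable `[a, b] (EFin \o f y).
  by move=> _; exact: segment_integrable.
have intM : mu.-integrable `[a, b] (EFin \o (fun _ : R => Num.max M 0)).
  by apply: segment_integrable; apply: continuous_subspaceT; exact: cst_continuous.
have der y t : `]x - 1, x + 1[%classic y -> `[a, b]%classic t -> derivable (f ^~ t) y 1.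
  by move=> _; rewrite /= in_itv /= => tab; have [] := D y t tab.
have bnd y t : `]x - 1, x + 1[%classic y -> `[a, b]%classic t ->
    `|partial1of2 f y t| <= Num.max M 0.
  by rewrite /= !in_itv /= => yI tab; rewrite dE // le_max dfM.
apply: DeriveDef.
  by apply: (@derivable_under_integral R _ _ mu f _ _ _ _ _ Ix intf der _ M0 intM bnd).
rewrite -derive1E.
rewrite (@differentiation_under_integral R _ _ mu f _ _ _ _ _ Ix intf der _ M0 intM bnd) //.
by apply: eq_Rintegral => t; rewrite inE /= in_itv /= => /dE.
Qed.

Lemma Rintegral_FTC2 (F f : R -> R) (a b : R) : a < b ->
  (forall t : R, a <= t <= b -> is_derive t 1 F (f t)) ->
  {within `[a, b], continuous f} -> \int[mu]_(t in `[a, b]) f t = F b - F a.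
Proof.
move=> ab D cf; rewrite /Rintegral (@continuous_FTC2 _ _ F) //.
- have C t : a <= t <= b -> {for t, continuous F}.
    move=> tab; apply/differentiable_continuous/derivable1_diffP.
    by have [] := D t tab.
  split => [t||].
  + rewrite in_itv /= => /andP[h1 h2].
    by have [] : is_derive t 1 F (f t) by apply: D; rewrite !ltW.
  + by apply: cvg_at_right_filter; apply: C; rewrite lexx ltW.
  + by apply: cvg_at_left_filter; apply: C; rewrite lexx ltW.
move=> t; rewrite in_itv /= => /andP[h1 h2]; rewrite derive1E.
by have [] : is_derive t 1 F (f t) by apply: D; rewrite !ltW.
Qed.

End ParametricIntegral.

(** * Orthant probabilities of correlated Gaussians *)

Section BivariateGaussian.
Variables (R : realType) (th0 : R).
Hypotheses (th0_gt0 : 0 < th0) (th0_lt : th0 < pi / 2).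
Local Notation mu := (@lebesgue_measure R).
Implicit Types s t th : R.

(* The density at (s, t) of a centred Gaussian vector with variances 1/2 and
   correlation sin th, in the form that makes d(sin th) disappear. *)
Definition pdens s t th : R :=
  expR (- (s ^+ 2 - 2 * s * t * sin th + t ^+ 2) * (cos th)^-1 ^+ 2) / (2 * pi).

Lemma cos_gt0_seg th : 0 <= th <= th0 -> 0 < cos th.
Proof.
move=> /andP[h0 h1]; apply: cos_gt0_pihalf; rewrite (le_lt_trans h1) // andbT.
by rewrite (lt_le_trans _ h0) // oppr_lt0 divr_gt0 ?pi_gt0.
Qed.

Lemma is_derive_cosV th : cos th != 0 ->
  is_derive th 1 (fun th => (cos th)^-1) (sin th * (cos th)^-1 ^+ 2).
Proof.
move=> c0; have D := is_deriveV c0 (is_derive_cos th).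
apply: (is_derive_eq D).
by rewrite /GRing.scale /= exprVn; ring.
Qed.

Definition logdens_th s t th : R := 2 * s * t * cos th * (cos th)^-1 ^+ 2 -
  (s ^+ 2 - 2 * s * t * sin th + t ^+ 2) * (2 * (cos th)^-1 * (sin th * (cos th)^-1 ^+ 2)).

Lemma is_derive_pdens_th s t th : cos th != 0 ->
  is_derive th 1 (pdens s t) (pdens s t th * logdens_th s t th).
Proof.
move=> c0; have D := is_derive_cosV c0; rewrite /pdens /logdens_th.
by apply: is_derive_eq; rewrite /GRing.scale /=; ring.
Qed.

Lemma continuous_pdens s t : {within `[0, th0], continuous (pdens s t)}.
Proof.
apply: (is_derive_continuous_segment
  (df := fun th => pdens s t th * logdens_th s t th)) => th thI.
exact: is_derive_pdens_th (lt0r_neq0 (cos_gt0_seg thI)).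
Qed.

Definition dpdens s t th : R :=
  pdens s t th * (2 * (t * sin th - s) * (cos th)^-1 ^+ 2).

Lemma is_derive_pdens s t th : is_derive s 1 (fun s => pdens s t th) (dpdens s t th).
Proof.
rewrite /dpdens /pdens.
by apply: is_derive_eq; rewrite /GRing.scale /=; ring.
Qed.

(** The normalised conditional threshold: given that the first Gaussian is s, the second is below t
    with probability [gcdf (slope s t th)]. *)
Definition slope s t th : R := (t - sin th * s) * (cos th)^-1.

Lemma pdens_gauss s t th : cos th != 0 ->
  pdens s t th = gauss_fun s * gauss_fun (slope s t th) / (2 * pi).
Proof.
move=> c0; rewrite /pdens /gauss_fun -expRD; congr (expR _ / _).
have -> : s ^+ 2 - 2 * s * t * sin th + t ^+ 2 =
    s ^+ 2 * (cos th ^+ 2 + sin th ^+ 2) - 2 * s * t * sin th + t ^+ 2.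
  by rewrite cos2Dsin2 mulr1.
by rewrite /slope; field.
Qed.

Lemma is_derive_slope s t th : cos th != 0 ->
  is_derive th 1 (slope s t) ((t * sin th - s) * (cos th)^-1 ^+ 2).
Proof.
move=> c0; have D := is_derive_cosV c0; rewrite /slope.
apply: is_derive_eq; rewrite /GRing.scale /=.
have -> : t * sin th - s = t * sin th - s * (cos th ^+ 2 + sin th ^+ 2).
  by rewrite cos2Dsin2 mulr1.
by field.
Qed.

(** The probability that the two Gaussians are below s and t, by Plackett's identity: its derivative
    in th is [pdens], and at th = 0 the Gaussians are independent. *)
Definition orthant s t : R :=
  gcdf s * gcdf t + \int[mu]_(th in `[0, th0]) pdens s t th.

(** The s-derivative of the density is an exact th-derivative, that of the density of s times the
    conditional probability. *)
Lemma dpdens_FTC s t :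
  \int[mu]_(th in `[0, th0]) dpdens s t th =
  gauss_fun s / Num.sqrt pi * gcdf (slope s t th0) -
  gauss_fun s / Num.sqrt pi * gcdf (slope s t 0).
Proof.
have spi : Num.sqrt pi != 0 :> R by rewrite gt_eqF ?sqrtpi_gt0.
have spi2 : 2 * pi = 2 * Num.sqrt pi ^+ 2 :> R by rewrite sqr_sqrtr ?pi_ge0.
pose F th := gauss_fun s / Num.sqrt pi * gcdf (slope s t th).
apply: (@Rintegral_FTC2 R F (dpdens s t) 0 th0 th0_gt0) => [th thI|].
  have c0 := lt0r_neq0 (cos_gt0_seg thI).
  have D := is_derive_slope s t c0.
  have D2 := @is_derive1_comp _ _ _ _ _ _ (is_derive_gcdf (slope s t th)) D.
  apply: (is_derive_eq (is_deriveZ (gauss_fun s / Num.sqrt pi) D2)).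
  rewrite /GRing.scale /= /dpdens (pdens_gauss _ _ c0) spi2.
  by field; rewrite c0 spi.
pose k th : R := 2 * (t * sin th - s) * (cos th)^-1 ^+ 2.
pose dk th : R := 2 * t * cos th * (cos th)^-1 ^+ 2 +
  2 * (t * sin th - s) * (2 * (cos th)^-1 * (sin th * (cos th)^-1 ^+ 2)).
apply: (is_derive_continuous_segment (df := fun th =>
  pdens s t th * dk th + k th * (pdens s t th * logdens_th s t th))) => th thI.
have c0 := lt0r_neq0 (cos_gt0_seg thI).
have D := is_derive_cosV c0.
have Dk : is_derive th 1 k (dk th).
  by rewrite /k /dk; apply: is_derive_eq; rewrite /GRing.scale /=; ring.
exact: (is_deriveM (is_derive_pdens_th s t c0) Dk).
Qed.

Lemma dpdens_bound s t th y : s - 1 < y < s + 1 -> 0 <= th <= th0 ->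
  `|dpdens y t th| <= (2 * pi)^-1 * (2 * (`|t| + (`|s| + 1)) * (cos th0)^-1 ^+ 2).
Proof.
move=> yI thI; have c0 := cos_gt0_seg thI; have pi0 := @pi_gt0 R.
have c00 : 0 < cos th0 by apply: cos_gt0_seg; rewrite ltW ?lexx.
have cle : cos th0 <= cos th.
  case/andP: thI => h0 h1; rewrite le_eqVlt; case: (ltgtP th th0) h1 => // [h1|->] _; last by rewrite eqxx.
  by rewrite ltr_cos ?h1 ?orbT // in_itv /=; apply/andP; split; move: th0_lt; lra.
rewrite /dpdens /pdens normrM [_ / _]mulrC.
have e1 : `|(2 * pi)^-1 * expR (- (y ^+ 2 - 2 * y * t * sin th + t ^+ 2) * (cos th)^-1 ^+ 2)| <= (2 * pi)^-1.
  have ci : 0 <= (2 * pi)^-1 :> R by rewrite invr_ge0 mulr_ge0 ?pi_ge0.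
  rewrite ger0_norm; last by rewrite mulr_ge0 ?expR_ge0.
  rewrite ler_piMr // -[leRHS]expR0 ler_expR.
  rewrite mulNr oppr_le0 mulr_ge0 ?sqr_ge0 //.
  (* The quadratic form is a sum of squares, so the exponential is at most 1. *)
  have -> : y ^+ 2 - 2 * y * t * sin th + t ^+ 2 =
    (y - sin th * t) ^+ 2 + t ^+ 2 * (1 - sin th ^+ 2) by ring.
  by rewrite -cos2sin2; apply: addr_ge0; [|apply: mulr_ge0]; exact: sqr_ge0.
apply: ler_pM => //; rewrite !normrM !(ger0_norm (ler0n R 2)).
have s1 : `|sin th| <= 1 by rewrite ler_norml sin_geN1 sin_le1.
apply: ler_pM; rewrite ?mulr_ge0 ?normr_ge0 //.
  rewrite ler_wpM2l // (le_trans (ler_normB _ _)) // lerD //.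
    by rewrite normrM ler_piMr.
  case/andP: yI => y1 y2; rewrite ler_norml; have := ler_norm s; have := ler_norm (- s).
  by rewrite normrN => ? ?; apply/andP; split; move: y1 y2; lra.
rewrite -normrM -expr2 ger0_norm ?sqr_ge0 //.
rewrite ler_sqr ?nnegrE ?invr_ge0 ?(ltW c0) ?(ltW c00) //.
by rewrite lef_pV2 ?posrE.
Qed.

(** At th = 0 the slope is t, so the lower boundary term of [dpdens_FTC] cancels the derivative of
    the product term. *)
Lemma is_derive_orthant s t :
  is_derive s 1 (orthant^~ t) (gauss_fun s / Num.sqrt pi * gcdf (slope s t th0)).
Proof.
have D1 : is_derive s 1 (fun s => \int[mu]_(th in `[0, th0]) pdens s t th)
   (\int[mu]_(th in `[0, th0]) dpdens s t th).
  apply: (@is_derive_Rintegral R (fun s => pdens s t) (fun s => dpdens s t) _ _ _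
    ((2 * pi)^-1 * (2 * (`|t| + (`|s| + 1)) * (cos th0)^-1 ^+ 2))).
  - by move=> y; exact: continuous_pdens.
  - by move=> y th _; exact: is_derive_pdens.
  - by move=> y th; exact: dpdens_bound.
rewrite /orthant; apply: is_derive_eq.
by rewrite dpdens_FTC /slope sin0 cos0 mul0r subr0 invr1 mulr1 /GRing.scale /=; ring.
Qed.

Lemma orthantC s t : orthant s t = orthant t s.
Proof.
rewrite /orthant mulrC; congr (_ + _); apply: eq_Rintegral => th _.
rewrite /pdens; have -> // : s ^+ 2 - 2 * s * t * sin th + t ^+ 2 =
  t ^+ 2 - 2 * t * s * sin th + s ^+ 2 by ring.
Qed.

Lemma orthant_ge s t : gcdf s * gcdf t <= orthant s t.
Proof.
rewrite lerDl Rintegral_ge0 // => th _.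
by rewrite divr_ge0 ?expR_ge0 ?mulr_ge0 ?pi_ge0.
Qed.

(** Sheppard's formula: at the origin [pdens] does not depend on th. *)
Lemma orthant00 : orthant 0 0 = 1 / 4 + th0 / (2 * pi).
Proof.
have pi0 : pi != 0 :> R by rewrite gt_eqF ?pi_gt0.
rewrite /orthant gcdf0; congr (_ + _); first by field.
have -> : \int[mu]_(th in `[0, th0]) pdens 0 0 th =
  \int[mu]_(th in `[0, th0]) (fun=> (2 * pi)^-1 : R) th.
  apply: eq_Rintegral => th _.
  by rewrite /pdens expr0n /= mulr0 !mul0r subr0 addr0 oppr0 mul0r expR0 mul1r.
have D x : 0 <= x <= th0 -> is_derive x 1 (fun x : R => x / (2 * pi)) (2 * pi)^-1.
  by move=> _; apply: is_derive_eq; rewrite /GRing.scale /=; ring.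
rewrite (Rintegral_FTC2 th0_gt0 D); first by rewrite mul0r subr0.
by apply: continuous_subspaceT; exact: cst_continuous.
Qed.

End BivariateGaussian.

(** * Second-order estimates with a cubic error *)

Section TaylorBounds.
Variable R : realType.
Implicit Types (f df d2f : R -> R) (x a M : R).

Lemma is_derive_shift f (c x d : R) : is_derive (c + x) 1 f d ->
  is_derive x 1 (fun x => f (c + x)) d.
Proof.
move=> D; have D1 : is_derive x 1 (fun x => c + x) 1.
  by have := is_deriveD (is_derive_cst c x 1) (is_derive_id x 1); rewrite add0r.
by have := is_derive1_comp D D1; rewrite mulr1.
Qed.

Lemma is_derive_reflect f (c x d : R) : is_derive (c - x) 1 f d ->
  is_derive x 1 (fun x => f (c - x)) (- d).
Proof.
move=> D; have D1 : is_derive x 1 (fun x => c - x) (- 1).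
  by have := is_deriveB (is_derive_cst c x 1) (is_derive_id x 1); rewrite add0r.
by have := @is_derive1_comp R f (fun x => c - x) x _ _ D D1; rewrite mulrN1.
Qed.

(** For z between 0 and |a|, M z^2 - (f(x + z) + f(x - z)) is nondecreasing: its derivative is 2 M z
    minus an increment of [df] over a length 2 z. *)
Lemma second_difference_le f df d2f x a M :
  (forall z : R, `|z - x| <= `|a| -> is_derive z 1 f (df z)) ->
  (forall z : R, `|z - x| <= `|a| -> is_derive z 1 df (d2f z)) ->
  (forall z : R, `|z - x| <= `|a| -> d2f z <= M) ->
  f (x + a) + f (x - a) <= 2 * f x + M * a ^+ 2.
Proof.
wlog a0 : a / 0 <= a => [H|] D1 D2 dM.
  case: (lerP 0 a) => a0; first exact: H.
  have := H (- a); rewrite normrN oppr_ge0 opprK sqrrN [f (x - a) + _]addrC.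
  by move/(_ (ltW a0)); apply.
rewrite ger0_norm // in D1 D2 dM.
pose v z : R := M * z ^+ 2 - (f (x + z) + f (x - z)).
pose dv z : R := M * (2 * z) - (df (x + z) - df (x - z)).
have vle : v 0 <= v a.
  apply: (@is_derive_ge0_le R v dv) => // z /andP[z0 za].
    have h1 : is_derive (x + z) 1 f (df (x + z)).
      by apply: D1; rewrite addrAC subrr add0r ger0_norm.
    have h2 : is_derive (x - z) 1 f (df (x - z)).
      by apply: D1; rewrite addrAC subrr add0r normrN ger0_norm.
    have h3 := is_derive_shift h1; have h4 := is_derive_reflect h2.
    by rewrite /v /dv; apply: is_derive_eq; rewrite /GRing.scale /=; ring.
  have xz : x - z <= x + z by lra.
  have zI t : x - z <= t <= x + z -> `|t - x| <= a.
    by move=> /andP[? ?]; rewrite ler_norml; apply/andP; split; lra.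
  have [t /andP[t1 t2]|c cI E] := @is_derive_MVT R df d2f _ _ xz.
    by apply: D2; apply: zI; rewrite t1 t2.
  rewrite /dv E.
  have := dM c (zI _ cI); have -> : x + z - (x - z) = 2 * z by ring.
  by move=> h; rewrite subr_ge0 ler_wpM2r // mulr_ge0.
move: vle; rewrite /v expr0n /= mulr0 addr0 subr0; lra.
Qed.

Lemma MVT_centered f df x a :
  (forall z : R, `|z - x| <= `|a| -> is_derive z 1 f (df z)) ->
  exists2 c, `|c - x| <= `|a| & f (x + a) - f (x - a) = df c * (2 * a).
Proof.
wlog a0 : a / 0 <= a => [H|] D1.
  case: (lerP 0 a) => a0; first exact: H.
  have := H (- a); rewrite normrN oppr_ge0 opprK => /(_ (ltW a0) D1) [c cI E].
  by exists c => //; rewrite -opprB E; ring.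
rewrite ger0_norm // in D1 *.
have zI t : x - a <= t <= x + a -> `|t - x| <= a.
  by move=> /andP[? ?]; rewrite ler_norml; apply/andP; split; lra.
have [|t /zI /D1 //|c /zI cI E] := @is_derive_MVT R f df (x - a) (x + a).
  by lra.
by exists c => //; rewrite E; ring.
Qed.

(** The four-point mean is the plain mean, controlled by second differences in each variable, plus
    rho/4 times a mixed difference, equal to 4 a b B at an intermediate point. Moving A and B back
    to (x, y) costs L (|a| + |b|), and the quadratic form that remains is nonpositive. *)
Lemma four_point_le (J P A B : R -> R -> R) (lo hi L rho x y a b : R) :
  0 <= rho <= 1 -> 0 <= L ->
  (forall x y, J x y = J y x) ->
  (forall x y : R, lo <= x <= hi -> lo <= y <= hi -> is_derive x 1 (J^~ y) (P x y)) ->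
  (forall x y : R, lo <= x <= hi -> lo <= y <= hi -> is_derive x 1 (P^~ y) (A x y)) ->
  (forall x y : R, lo <= x <= hi -> lo <= y <= hi -> is_derive y 1 (P x) (B x y)) ->
  (forall x y x' y' : R, lo <= x <= hi -> lo <= y <= hi ->
    lo <= x' <= hi -> lo <= y' <= hi ->
    `|A x' y' - A x y| <= L * (`|x' - x| + `|y' - y|)) ->
  (forall x y x' y' : R, lo <= x <= hi -> lo <= y <= hi ->
    lo <= x' <= hi -> lo <= y' <= hi ->
    `|B x' y' - B x y| <= L * (`|x' - x| + `|y' - y|)) ->
  (forall x y : R, lo <= x <= hi -> lo <= y <= hi ->
    a ^+ 2 * A x y + 2 * rho * (a * b) * B x y + b ^+ 2 * A y x <= 0) ->
  lo <= x + a <= hi -> lo <= x - a <= hi -> lo <= y + b <= hi -> lo <= y - b <= hi ->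
  four_point rho J x y a b <= J x y + 4 * L * (`|a| ^+ 3 + `|b| ^+ 3).
Proof.
move=> /andP[r0 r1] L0 JC DJ DA DB LA LB neg xa1 xa2 yb1 yb2.
have inD (z c d : R) : `|z - c| <= `|d| -> lo <= c + d <= hi -> lo <= c - d <= hi -> lo <= z <= hi.
  move=> h /andP[h1 h2] /andP[h3 h4]; move: h; rewrite ler_norml => /andP[h5 h6].
  by case: (ger0P d) h5 h6 => d0 h5 h6; apply/andP; split; lra.
have xD : lo <= x <= hi by apply: (inD _ x a) => //; rewrite subrr normr0.
have yD : lo <= y <= hi by apply: (inD _ y b) => //; rewrite subrr normr0.
have dist (c d : R) : `|c + d - c| = `|d| by rewrite addrAC subrr add0r.
have S1 y' : lo <= y' <= hi -> `|y' - y| <= `|b| ->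
    J (x + a) y' + J (x - a) y' <= 2 * J x y' + (A x y + L * (`|a| + `|b|)) * a ^+ 2.
  move=> y'D y'b; apply: (@second_difference_le (J^~ y') (P^~ y') (A^~ y')).
  - by move=> z /inD zD; apply: DJ => //; exact: zD.
  - by move=> z /inD zD; apply: DA => //; exact: zD.
  move=> z zx; have zD := inD _ _ _ zx xa1 xa2.
  have := LA _ _ _ _ xD yD zD y'D; rewrite ler_norml => /andP[_].
  have : L * (`|z - x| + `|y' - y|) <= L * (`|a| + `|b|) by rewrite ler_wpM2l // lerD.
  by lra.
have S2 : J (y + b) x + J (y - b) x <= 2 * J y x + (A y x + L * (`|a| + `|b|)) * b ^+ 2.
  apply: (@second_difference_le (J^~ x) (P^~ x) (A^~ x)).
  - by move=> z /inD zD; apply: DJ => //; exact: zD.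
  - by move=> z /inD zD; apply: DA => //; exact: zD.
  move=> z zy; have zD := inD _ _ _ zy yb1 yb2.
  have := LA _ _ _ _ yD xD zD xD; rewrite ler_norml => /andP[_].
  have : L * (`|z - y| + `|x - x|) <= L * (`|a| + `|b|).
    by rewrite ler_wpM2l // subrr normr0 addrC lerD.
  by lra.
have [c1 c1x E1] : exists2 c, `|c - x| <= `|a| &
    (J (x + a) (y + b) - J (x + a) (y - b)) - (J (x - a) (y + b) - J (x - a) (y - b)) =
    (P c (y + b) - P c (y - b)) * (2 * a).
  apply: (@MVT_centered (fun z => J z (y + b) - J z (y - b))
                        (fun z => P z (y + b) - P z (y - b))) => z /inD zD.
  have := DJ _ _ (zD xa1 xa2) yb1; have := DJ _ _ (zD xa1 xa2) yb2 => D2 D1.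
  exact: is_deriveB.
have c1D := inD _ _ _ c1x xa1 xa2.
have [c2 c2y E2] : exists2 c, `|c - y| <= `|b| &
    P c1 (y + b) - P c1 (y - b) = B c1 c * (2 * b).
  by apply: MVT_centered => z /inD zD; apply: DB => //; exact: zD.
have c2D := inD _ _ _ c2y yb1 yb2.
have S3 : a * b * B c1 c2 <= a * b * B x y + `|a| * `|b| * (L * (`|a| + `|b|)).
  have h := LB _ _ _ _ xD yD c1D c2D.
  rewrite -lerBlDl -mulrBr (le_trans (ler_norm _)) // !normrM ler_wpM2l ?mulr_ge0 //.
  by rewrite (le_trans h) // ler_wpM2l // lerD.
have := S1 _ yb1; rewrite dist => /(_ (lexx _)) h1.
have := S1 _ yb2; rewrite dist normrN => /(_ (lexx _)) h2.
have h3 := neg x y xD yD.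
move: S2; rewrite (JC (y + b)) (JC (y - b)) (JC y) => S2.
have h4 : rho * (a * b * B c1 c2) <= rho * (a * b * B x y) + `|a| * `|b| * (L * (`|a| + `|b|)).
  apply: le_trans (ler_wpM2l r0 S3) _; rewrite mulrDr lerD2l ler_piMl //.
  by rewrite !mulr_ge0 // addr_ge0.
have M : (J (x + a) (y + b) - J (x + a) (y - b)) - (J (x - a) (y + b) - J (x - a) (y - b)) =
   4 * (a * b * B c1 c2) by rewrite E1 E2; ring.
(* The left side is L (|a| + |b|)^3; its mixed terms are absorbed by p^3 + q^3 - p^2 q - p q^2 = (p
   + q)(p - q)^2 >= 0. *)
have K : L * (`|a| + `|b|) * a ^+ 2 + L * (`|a| + `|b|) * b ^+ 2 + 2 * (`|a| * `|b| * (L * (`|a| + `|b|)))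
   <= 8 * L * (`|a| ^+ 3 + `|b| ^+ 3).
  rewrite -[a ^+ 2]real_normK ?num_real // -[b ^+ 2]real_normK ?num_real //.
  have := normr_ge0 a; have := normr_ge0 b; move: `|a| `|b| => p q q0 p0.
  have : 0 <= L * ((p + q) * (p - q) ^+ 2).
    by rewrite mulr_ge0 // mulr_ge0 ?sqr_ge0 // addr_ge0.
  have : 0 <= L * (p ^+ 3 + q ^+ 3) by rewrite mulr_ge0 // addr_ge0 ?exprn_ge0.
  rewrite !exprS !expr0; lra.
have -> : four_point rho J x y a b =
  (J (x + a) (y + b) + J (x - a) (y + b) + (J (x + a) (y - b) + J (x - a) (y - b))) / 4 +
  rho * ((J (x + a) (y + b) - J (x + a) (y - b)) - (J (x - a) (y + b) - J (x - a) (y - b))) / 4.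
  by rewrite /four_point; field.
rewrite M.
lra.
Qed.

End TaylorBounds.

(** * The Borell function and its Hessian *)

Section BorellFunction.
Variables (R : realType) (th0 : R).
Hypotheses (th0_gt0 : 0 < th0) (th0_lt : th0 < pi / 2).
Implicit Types s t x y a b e : R.
Local Notation sl s t := (slope s t th0).
Local Notation c := (cos th0)^-1.
Local Notation rho := (sin th0).

Lemma cos_th0_gt0 : 0 < cos th0.
Proof. by apply: (cos_gt0_seg (th0 := th0)) => //; rewrite lexx ltW. Qed.

Lemma sin_th0_gt0 : 0 < rho.
Proof. by apply: sin_gt0_pihalf; rewrite th0_gt0. Qed.

(** Both sides are minus the exponent of the joint density, which is symmetric. *)
Lemma slopeC s t : s ^+ 2 + sl s t ^+ 2 = t ^+ 2 + sl t s ^+ 2.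
Proof.
have c0 : cos th0 != 0 by rewrite gt_eqF ?cos_th0_gt0.
have E x y : x ^+ 2 + sl x y ^+ 2 = (x ^+ 2 - 2 * x * y * rho + y ^+ 2) * c ^+ 2.
  have -> : x ^+ 2 - 2 * x * y * rho + y ^+ 2 =
    x ^+ 2 * (cos th0 ^+ 2 + rho ^+ 2) - 2 * x * y * rho + y ^+ 2.
    by rewrite cos2Dsin2 mulr1.
  by rewrite /slope; field.
by rewrite !E; ring.
Qed.

(** The orthant probability as a function of the two marginal probabilities. In its x-derivative the
    density of the first Gaussian cancels against the derivative of the quantile, leaving the
    conditional probability [dborell]. *)
Definition borell x y : R := orthant th0 (gquant x) (gquant y).
Definition dborell x y : R := gcdf (sl (gquant x) (gquant y)).
Definition borell_xx x y : R :=
  - (rho * c) * expR (gquant x ^+ 2 - sl (gquant x) (gquant y) ^+ 2).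
Definition borell_xy x y : R :=
  c * expR (gquant y ^+ 2 - sl (gquant x) (gquant y) ^+ 2).

Lemma borellC x y : borell x y = borell y x.
Proof. exact: orthantC. Qed.

Lemma gauss_div s u : gauss_fun u / gauss_fun s = expR (s ^+ 2 - u ^+ 2).
Proof. by rewrite /gauss_fun -expRN opprK -expRD addrC. Qed.

Lemma is_derive_borell x y : 0 < x < 1 -> is_derive x 1 (borell^~ y) (dborell x y).
Proof.
move=> x01; have D := is_derive_gquant x01.
have D1 := is_derive_orthant th0_gt0 th0_lt (gquant x) (gquant y).
have := @is_derive1_comp R (fun s => orthant th0 s (gquant y)) (@gquant R) x _ _ D1 D.
move=> D2; apply: (is_derive_eq D2).
have g0 : gauss_fun (gquant x) != 0 by rewrite gt_eqF ?gauss_fun_gt0.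
have s0 : Num.sqrt pi != 0 :> R by rewrite gt_eqF ?sqrtpi_gt0.
by rewrite /dborell; field; rewrite g0 s0.
Qed.

Lemma is_derive_dborell_x x y : 0 < x < 1 ->
  is_derive x 1 (dborell^~ y) (borell_xx x y).
Proof.
move=> x01; have D := is_derive_gquant x01.
have D1 : is_derive x 1 (fun x => sl (gquant x) (gquant y))
    (- (rho * c) * (Num.sqrt pi / gauss_fun (gquant x))).
  by rewrite /slope; apply: is_derive_eq; rewrite /GRing.scale /=; ring.
have := @is_derive1_comp R (@gcdf R) (fun x => sl (gquant x) (gquant y)) x _ _ (is_derive_gcdf _) D1.
move=> D2; apply: (is_derive_eq D2).
have g0 : gauss_fun (gquant x) != 0 by rewrite gt_eqF ?gauss_fun_gt0.
have s0 : Num.sqrt pi != 0 :> R by rewrite gt_eqF ?sqrtpi_gt0.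
by rewrite /borell_xx -gauss_div; field; rewrite g0 s0 gt_eqF // cos_th0_gt0.
Qed.

Lemma is_derive_dborell_y x y : 0 < y < 1 ->
  is_derive y 1 (dborell x) (borell_xy x y).
Proof.
move=> y01; have D := is_derive_gquant y01.
have D1 : is_derive y 1 (fun y => sl (gquant x) (gquant y))
    (c * (Num.sqrt pi / gauss_fun (gquant y))).
  by rewrite /slope; apply: is_derive_eq; rewrite /GRing.scale /=; ring.
have := @is_derive1_comp R (@gcdf R) (fun y => sl (gquant x) (gquant y)) y _ _ (is_derive_gcdf _) D1.
move=> D2; apply: (is_derive_eq D2).
have g0 : gauss_fun (gquant y) != 0 by rewrite gt_eqF ?gauss_fun_gt0.
have s0 : Num.sqrt pi != 0 :> R by rewrite gt_eqF ?sqrtpi_gt0.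
by rewrite /borell_xy -gauss_div; field; rewrite g0 s0 gt_eqF // cos_th0_gt0.
Qed.

(* The Hessian of the Borell function, with its mixed term weighted by rho, is
   degenerate: it is minus the square of a linear form. *)
Lemma borell_hessian_le0 x y a b :
  a ^+ 2 * borell_xx x y + 2 * rho * (a * b) * borell_xy x y +
  b ^+ 2 * borell_xx y x <= 0.
Proof.
set s := gquant x; set t := gquant y.
(* By [slopeC], the three exponentials are w, w k and w k^2 for the w and k introduced below, whence
   a perfect square. *)
have E : expR (t ^+ 2 - sl t s ^+ 2) =
    expR (s ^+ 2 - sl s t ^+ 2) * expR (t ^+ 2 - s ^+ 2) ^+ 2.
  rewrite (expr2 (expR _)) -!expRD; congr expR; have := slopeC s t; lra.
have E' : expR (t ^+ 2 - sl s t ^+ 2) =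
    expR (s ^+ 2 - sl s t ^+ 2) * expR (t ^+ 2 - s ^+ 2).
  by rewrite -expRD; congr expR; ring.
rewrite /borell_xx /borell_xy -/s -/t E E'.
move: (expR (s ^+ 2 - sl s t ^+ 2)) (expR_ge0 (s ^+ 2 - sl s t ^+ 2)) => w w0.
move: (expR (t ^+ 2 - s ^+ 2)) => k.
have -> : a ^+ 2 * (- (rho * c) * w) + 2 * rho * (a * b) * (c * (w * k)) +
   b ^+ 2 * (- (rho * c) * (w * k ^+ 2)) = - (rho * c * w * (a - b * k) ^+ 2) by ring.
have c0 : 0 <= c by rewrite invr_ge0 ltW // cos_th0_gt0.
have r0 := ltW sin_th0_gt0.
by rewrite oppr_le0 (mulr_ge0 _ (sqr_ge0 _)) // !mulr_ge0.
Qed.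

Lemma expR_lipschitz (M u v : R) : u <= M -> v <= M ->
  `|expR u - expR v| <= expR M * `|u - v|.
Proof.
wlog uv : u v / u <= v => [H uM vM|uM vM].
  case/orP: (le_total u v) => uv; first exact: H.
  by rewrite distrC [`|u - v|]distrC; exact: H.
have [z /andP[_ zv] E] := @is_derive_MVT R expR expR u v uv (fun z _ => is_derive_expR z).
rewrite distrC [`|u - v|]distrC E normrM ger0_norm ?expR_ge0 // ler_wpM2r //.
by rewrite ler_expR (le_trans zv).
Qed.

Lemma gquant_le x y : 0 < x < 1 -> 0 < y < 1 -> x <= y -> gquant x <= gquant y.
Proof.
move=> x01 y01; rewrite leNgt => xy; rewrite leNgt; apply: contra xy => /gcdf_lt.
by rewrite !gcdfK.
Qed.

Lemma gquant_bound e x : 0 < e -> e <= x <= 1 - e -> e < 1 / 2 ->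
  `|gquant x| <= `|gquant e| + `|gquant (1 - e)|.
Proof.
move=> e0 /andP[ex xe] e2.
have h1 : gquant e <= gquant x by apply: gquant_le => //; apply/andP; split; lra.
have h2 : gquant x <= gquant (1 - e) by apply: gquant_le => //; apply/andP; split; lra.
rewrite ler_norml; have := ler_norm (gquant (1 - e)); have := ler_norm (- gquant e).
have := normr_ge0 (gquant (1 - e)); have := normr_ge0 (gquant e).
rewrite normrN; move=> ? ? ? ?; apply/andP; split; lra.
Qed.

Lemma gquant_lipschitz e : 0 < e -> e < 1 / 2 -> exists2 K, 0 <= K &
  forall x y, e <= x <= 1 - e -> e <= y <= 1 - e ->
    `|gquant x - gquant y| <= K * `|x - y|.
Proof.
move=> e0 e2; set B := `|gquant e| + `|gquant (1 - e)|.
exists (Num.sqrt pi * expR (B ^+ 2)); first by rewrite mulr_ge0 ?sqrtr_ge0 ?expR_ge0.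
move=> x y; wlog xy : x y / x <= y => [H xI yI|/andP[x0 x1] /andP[y0 y1]].
  case/orP: (le_total x y) => xy; first exact: H.
  by rewrite distrC [`|x - y|]distrC; exact: H.
have zI z : x <= z <= y -> 0 < z < 1 /\ e <= z <= 1 - e.
  by move=> /andP[h1 h2]; split; apply/andP; split; lra.
have [z /zI[z01 _]|z /zI[z01 ze] E] := @is_derive_MVT R (@gquant R)
   (fun z => Num.sqrt pi / gauss_fun (gquant z)) x y xy.
  exact: is_derive_gquant.
rewrite distrC [`|x - y|]distrC E normrM ler_wpM2r //.
rewrite normrM ger0_norm ?sqrtr_ge0 // ler_wpM2l ?sqrtr_ge0 //.
rewrite ger0_norm ?invr_ge0 ?gauss_fun_ge0 // /gauss_fun -expRN opprK ler_expR.
rewrite -real_normK ?num_real // ler_sqr ?nnegrE ?addr_ge0 //.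
exact: gquant_bound.
Qed.

Lemma sqr_diff_lipschitz (B u v : R) : `|u| <= B -> `|v| <= B ->
  `|u ^+ 2 - v ^+ 2| <= 2 * B * `|u - v|.
Proof.
move=> uB vB; rewrite subr_sqr mulrC normrM ler_wpM2r //.
by rewrite (le_trans (ler_normD _ _)) //; lra.
Qed.

Lemma slope_bound B s t : `|s| <= B -> `|t| <= B -> `|sl s t| <= 2 * B * c.
Proof.
have c0 : 0 <= c by rewrite invr_ge0 ltW // cos_th0_gt0.
move=> sB tB; rewrite /slope normrM (ger0_norm c0) ler_wpM2r //.
rewrite (le_trans (ler_normB _ _)) // normrM.
have : `|rho| * `|s| <= 1 * B by rewrite ler_pM // ler_norml sin_geN1 sin_le1.
by lra.
Qed.

Lemma slope_lipschitz s t s' t' : `|sl s' t' - sl s t| <= c * (`|s' - s| + `|t' - t|).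
Proof.
have c0 : 0 <= c by rewrite invr_ge0 ltW // cos_th0_gt0.
have -> : sl s' t' - sl s t = c * ((t' - t) - rho * (s' - s)) by rewrite /slope; ring.
rewrite normrM (ger0_norm c0) ler_wpM2l // (le_trans (ler_normB _ _)) // addrC lerD //.
by rewrite normrM ler_piMl // ler_norml sin_geN1 sin_le1.
Qed.

(** On [e, 1 - e] the quantiles and slopes are bounded and Lipschitz, and the entries are
    exponentials of differences of their squares. *)
Lemma hessian_lipschitz e : 0 < e -> e < 1 / 2 -> exists2 L, 0 <= L &
  (forall x y x' y', e <= x <= 1 - e -> e <= y <= 1 - e ->
    e <= x' <= 1 - e -> e <= y' <= 1 - e ->
    `|borell_xx x' y' - borell_xx x y| <= L * (`|x' - x| + `|y' - y|)) /\
  (forall x y x' y', e <= x <= 1 - e -> e <= y <= 1 - e ->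
    e <= x' <= 1 - e -> e <= y' <= 1 - e ->
    `|borell_xy x' y' - borell_xy x y| <= L * (`|x' - x| + `|y' - y|)).
Proof.
move=> e0 e2; have [K K0 QK] := gquant_lipschitz e0 e2.
set B := `|gquant e| + `|gquant (1 - e)|.
have B0 : 0 <= B by rewrite addr_ge0.
have c0 : 0 <= c by rewrite invr_ge0 ltW // cos_th0_gt0.
have QB x : e <= x <= 1 - e -> `|gquant x| <= B by move=> xe; exact: gquant_bound.
pose L0 := expR (B ^+ 2) * ((2 * B + 2 * (2 * B * c) * c) * K).
have L00 : 0 <= L0 by rewrite mulr_ge0 ?expR_ge0 // mulr_ge0 // addr_ge0 ?mulr_ge0.
(* r and r' are the quantiles of x and x' for [borell_xx], of y and y' for [borell_xy]. *)
have core (r r' x y x' y' : R) : `|r| <= B -> `|r'| <= B ->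
    `|r' - r| <= K * (`|x' - x| + `|y' - y|) ->
    e <= x <= 1 - e -> e <= y <= 1 - e -> e <= x' <= 1 - e -> e <= y' <= 1 - e ->
    `|expR (r' ^+ 2 - sl (gquant x') (gquant y') ^+ 2) -
      expR (r ^+ 2 - sl (gquant x) (gquant y) ^+ 2)| <= L0 * (`|x' - x| + `|y' - y|).
  move=> rB r'B rr xe ye x'e y'e.
  set d := `|x' - x| + `|y' - y| in rr *.
  set u := sl _ _; set v := sl _ _.
  have bnd (w z : R) : `|w| <= B -> w ^+ 2 - z ^+ 2 <= B ^+ 2.
    move=> wB; have := sqr_ge0 z; have : w ^+ 2 <= B ^+ 2.
      by rewrite -real_normK ?num_real // ler_sqr ?nnegrE.
    by lra.
  apply: le_trans (expR_lipschitz (bnd _ u r'B) (bnd _ v rB)) _.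
  rewrite /L0 -mulrA ler_wpM2l ?expR_ge0 //.
  have -> : r' ^+ 2 - u ^+ 2 - (r ^+ 2 - v ^+ 2) = (r' ^+ 2 - r ^+ 2) - (u ^+ 2 - v ^+ 2) by ring.
  apply: le_trans (ler_normB _ _) _.
  have -> : (2 * B + 2 * (2 * B * c) * c) * K * d =
    2 * B * (K * d) + 2 * (2 * B * c) * c * (K * d) by ring.
  apply: lerD.
    by apply: le_trans (sqr_diff_lipschitz r'B rB) _; rewrite ler_wpM2l // mulr_ge0.
  have uB : `|u| <= 2 * B * c by apply: slope_bound; exact: QB.
  have vB : `|v| <= 2 * B * c by apply: slope_bound; exact: QB.
  apply: le_trans (sqr_diff_lipschitz uB vB) _.
  rewrite -(mulrA (2 * (2 * B * c))) ler_wpM2l ?mulr_ge0 //.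
  apply: le_trans (slope_lipschitz _ _ _ _) _; rewrite ler_wpM2l // mulrDr.
  by apply: lerD; exact: QK.
exists (c * L0); first exact: mulr_ge0.
have r1 : `|rho * c| <= c.
  by rewrite normrM (ger0_norm c0) ler_piMl // ler_norml sin_geN1 sin_le1.
split=> x y x' y' xe ye x'e y'e.
  rewrite /borell_xx -mulrBr normrM normrN -mulrA; apply: ler_pM => //.
  apply: core => //; try exact: QB.
  by apply: le_trans (QK _ _ x'e xe) _; rewrite ler_wpM2l // lerDl.
rewrite /borell_xy -mulrBr normrM (ger0_norm c0) -mulrA ler_wpM2l //.
apply: core => //; try exact: QB.
by apply: le_trans (QK _ _ y'e ye) _; rewrite ler_wpM2l // lerDr.
Qed.

(** The map u -> 1/2 + kappa u sends [-1, 1] onto [e, 1 - e] with e = 1/2 - kappa, away from 0 and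
    1, where the quantiles blow up. *)
Lemma borell_rho_concave kappa : 0 < kappa < 1 / 2 -> exists J C,
  [/\ 0 <= C, rho_concave rho J C, J 0 0 = 1 / 4 + th0 / (2 * pi) &
   forall u v, `|u| <= 1 -> `|v| <= 1 ->
     (1 / 2 + kappa * u) * (1 / 2 + kappa * v) <= J u v].
Proof.
move=> /andP[k0 k1]; pose e : R := 1 / 2 - kappa.
have e0 : 0 < e by rewrite /e; lra.
have e2 : e < 1 / 2 by rewrite /e; lra.
have [L L0 [LA LB]] := hessian_lipschitz e0 e2.
have inI u : `|u| <= 1 -> e <= 1 / 2 + kappa * u <= 1 - e.
  by rewrite ler_norml /e => /andP[u1 u2]; apply/andP; split; nra.
have in01 x : e <= x <= 1 - e -> 0 < x < 1.
  by move=> /andP[h1 h2]; apply/andP; split; lra.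
exists (fun u v => borell (1 / 2 + kappa * u) (1 / 2 + kappa * v)), (4 * L).
split=> [|x y a b xa1 xa2 yb1 yb2||u v /inI/in01 uI /inI/in01 vI].
- by rewrite mulr_ge0.
- have shift u d : 1 / 2 + kappa * (u + d) = 1 / 2 + kappa * u + kappa * d by ring.
  have shiftB u d : 1 / 2 + kappa * (u - d) = 1 / 2 + kappa * u - kappa * d by ring.
  have rho01 : 0 <= rho <= 1 by rewrite sin_le1 andbT ltW // sin_th0_gt0.
  have D1 x' y' : e <= x' <= 1 - e -> e <= y' <= 1 - e ->
    is_derive x' 1 (borell^~ y') (dborell x' y').
    by move=> /in01 h _; exact: is_derive_borell.
  have D2 x' y' : e <= x' <= 1 - e -> e <= y' <= 1 - e ->
    is_derive x' 1 (dborell^~ y') (borell_xx x' y').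
    by move=> /in01 h _; exact: is_derive_dborell_x.
  have D3 x' y' : e <= x' <= 1 - e -> e <= y' <= 1 - e ->
    is_derive y' 1 (dborell x') (borell_xy x' y').
    by move=> _ /in01 h; exact: is_derive_dborell_y.
  have xa1' := inI _ xa1; have xa2' := inI _ xa2.
  have yb1' := inI _ yb1; have yb2' := inI _ yb2.
  rewrite shift in xa1'; rewrite shiftB in xa2'.
  rewrite shift in yb1'; rewrite shiftB in yb2'.
  have H := four_point_le rho01 L0 borellC D1 D2 D3 LA LB
    (fun x y _ _ => borell_hessian_le0 x y (kappa * a) (kappa * b)) xa1' xa2' yb1' yb2'.
  rewrite /four_point !shiftB !shift; apply: (le_trans H).
  rewrite lerD2l ler_wpM2l ?mulr_ge0 //.
  have kn (z : R) : `|kappa * z| <= `|z|.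
    by rewrite normrM ler_piMl // ger0_norm ltW //; lra.
  by apply: lerD; rewrite lerXn2r ?nnegrE.
- by rewrite !mulr0 !addr0 /borell gquant_half orthant00.
by rewrite -{1}(gcdfK uI) -{1}(gcdfK vI) orthant_ge.
Qed.

End BorellFunction.

(** * Fourier weights of majority *)

Section SymmetricFunctions.
Variable R : realType.
Implicit Types F G : nat -> R.

(** What [cavg] and [cdiff] become on functions of the number of true bits. *)
Definition savg F : nat -> R := fun j => (F j.+1 + F j) / 2.
Definition sdiff F : nat -> R := fun j => (F j.+1 - F j) / 2.

(* The Fourier coefficient, at any set of size k, of the function on the cube of
   dimension a + k that takes the value F j at the points with j true bits. *)
Definition scoef a k F : R := iter a savg (iter k sdiff F) 0%N.

Definition of_count n F : cube n -> R := fun x => F (\sum_(i < n) (x i : nat))%N.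

Lemma count_fcons n b (x : cube n) :
  (\sum_(i < n.+1) (fcons b x i : nat) = b + \sum_(i < n) (x i : nat))%N.
Proof.
rewrite big_ord_recl fcons0; congr (_ + _)%N.
by apply: eq_bigr => i _; rewrite fconsS.
Qed.

Lemma avg_of_count n F : cavg (@of_count n.+1 F) =1 of_count (savg F).
Proof. by move=> x; rewrite /cavg /of_count !count_fcons. Qed.

Lemma diff_of_count n F : cdiff (@of_count n.+1 F) =1 of_count (sdiff F).
Proof. by move=> x; rewrite /cdiff /of_count !count_fcons. Qed.

Lemma savg_sdiff F : savg (sdiff F) = sdiff (savg F).
Proof. by apply: funext => j; rewrite /savg /sdiff; field. Qed.

Lemma scoef_savg a k F : scoef a k (savg F) = scoef a.+1 k F.
Proof.
rewrite /scoef iterSr; congr (iter a savg _ _).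
by elim: k => //= k ->; rewrite savg_sdiff.
Qed.

Lemma scoef_sdiff a k F : scoef a k (sdiff F) = scoef a k.+1 F.
Proof. by rewrite /scoef iterSr. Qed.

Lemma scoefD a k F G : scoef a k (fun j => F j + G j) = scoef a k F + scoef a k G.
Proof.
elim: a => [|a IH] in F G *; last first.
  rewrite -!scoef_savg -IH; congr scoef.
  by apply: funext => j; rewrite /savg; field.
elim: k => [|k IH] // in F G *; rewrite -!scoef_sdiff -IH; congr scoef.
by apply: funext => j; rewrite /sdiff; field.
Qed.

Lemma scoefZ a k c F : scoef a k (fun j => c * F j) = c * scoef a k F.
Proof.
elim: a => [|a IH] in F *; last first.
  rewrite -!scoef_savg -IH; congr scoef.
  by apply: funext => j; rewrite /savg; field.
elim: k => [|k IH] // in F *; rewrite -!scoef_sdiff -IH; congr scoef.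
by apply: funext => j; rewrite /sdiff; field.
Qed.

(** All sets of one size have the same coefficient; the induction is Pascal's rule. *)
Lemma energy_of_count n w F : energy w (@of_count n F) =
  \sum_(k < n.+1) 'C(n, k)%:R * (w k * scoef (n - k) k F ^+ 2).
Proof.
elim: n => [|n IH] in w F *.
  by rewrite big_ord1 /= /of_count big_ord0 /scoef /= mul1r.
have -> : energy w (@of_count n.+1 F) =
    energy w (@of_count n (savg F)) + energy (w \o S) (@of_count n (sdiff F)).
  congr (_ + _); apply: eq_energy => //; [exact: avg_of_count|exact: diff_of_count].
rewrite !IH big_ord_recl [RHS]big_ord_recl !bin0 !subn0 scoef_savg -addrA; congr (_ + _).
have -> : \sum_(i < n) 'C(n, bump 0 i)%:R *
    (w (bump 0 i) * scoef (n - bump 0 i) (bump 0 i) (savg F) ^+ 2) =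
   \sum_(i < n.+1) 'C(n, i.+1)%:R * (w i.+1 * scoef (n - i) i.+1 F ^+ 2).
  rewrite big_ord_recr /= bin_small // mul0r addr0; apply: eq_bigr => i _.
  by rewrite scoef_savg /bump /= add1n subnSK.
rewrite -big_split; apply: eq_bigr => i _ /=.
by rewrite scoef_sdiff /bump /= add1n binS natrD mulrDl subSS.
Qed.

(* Fourier coefficients of the product of F with the sum of all the +-1 bits. *)
Lemma scoef_mul_sum a k F :
  scoef a k (fun j => (2 * j%:R - (a + k)%:R) * F j) =
  a%:R * scoef a.-1 k.+1 F + k%:R * scoef a.+1 k.-1 F.
Proof.
elim: a k F => [|a IH] k F; last first.
  rewrite -scoef_savg.
  (* Splitting off a sign s, the mean of (s + rest)(savg F + s sdiff F) over s is rest times savg F,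
     plus sdiff F. *)
  have -> : savg (fun j => (2 * j%:R - (a.+1 + k)%:R) * F j) =
     (fun j => (2 * j%:R - (a + k)%:R) * savg F j + sdiff F j).
    apply: funext => j; by rewrite /savg /sdiff addSn -!natr1; field.
  rewrite scoefD IH scoef_sdiff /=.
  have -> : a%:R * scoef a.-1 k.+1 (savg F) = a%:R * scoef a k.+1 F.
    by case: (a) => [|b]; rewrite ?mul0r // scoef_savg.
  by rewrite scoef_savg -natr1; ring.
elim: k F => [|k IH] F; first by rewrite /scoef /= subr0 mulr0 !mul0r addr0.
rewrite -scoef_sdiff.
have -> : sdiff (fun j => (2 * j%:R - (0 + k.+1)%:R) * F j) =
   (fun j => (2 * j%:R - (0 + k)%:R) * sdiff F j + savg F j).
  by apply: funext => j; rewrite /savg /sdiff !add0n -!natr1; field.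
rewrite scoefD IH scoef_savg /= mul0r add0r mul0r add0r.
have -> : k%:R * scoef 1 k.-1 (sdiff F) = k%:R * scoef 1 k F.
  by case: (k) => [|b]; rewrite ?mul0r // scoef_sdiff.
by rewrite -natr1; ring.
Qed.

Definition tie m : nat -> R := fun j => (j == m)%:R.

Lemma scoef_tie_rec m a k : (a + k = m.*2)%N ->
  a%:R * scoef a.-1 k.+1 (tie m) = - (k%:R * scoef a.+1 k.-1 (tie m)).
Proof.
move=> akm; apply/eqP; rewrite -addr_eq0 -scoef_mul_sum akm.
have -> : (fun j => (2 * j%:R - m.*2%:R) * tie m j) = (fun j => 0 * tie m j).
  apply: funext => j; rewrite /tie; case: eqP => [->|]; last by rewrite !mulr0.
  by rewrite -mul2n natrM subrr !mul0r.
by rewrite scoefZ mul0r.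
Qed.

Lemma scoef_tie0 n (j : nat) : scoef n 0 (tie j) = 'C(n, j)%:R / 2 ^+ n.
Proof.
elim: n => [|n IH] in j *.
  by rewrite /scoef /= /tie expr0 divr1 eq_sym; case: j.
rewrite -scoef_savg; case: j => [|j].
  have -> : savg (tie 0) = (fun i => 2^-1 * tie 0 i).
    by apply: funext => i; rewrite /savg /tie add0r mulrC.
  by rewrite scoefZ IH !bin0 exprS !div1r invfM.
have -> : savg (tie j.+1) = (fun i => 2^-1 * tie j i + 2^-1 * tie j.+1 i).
  by apply: funext => i; rewrite /savg /tie eqSS -mulrDr mulrC.
by rewrite scoefD !scoefZ !IH binS natrD exprS invfM; ring.
Qed.

(** The probability of a tie among 2m fair votes, and the coefficient of x^(2m) in (1 -
    x^2)^(-1/2). *)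
Fixpoint wallis m : R :=
  if m is m'.+1 then wallis m' * ((m'.*2.+1)%:R / (m'.*2.+2)%:R) else 1.

Lemma wallis_gt0 m : 0 < wallis m.
Proof. by elim: m => //= m IH; rewrite mulr_gt0 // divr_gt0 ?ltr0n. Qed.

Lemma wallisS m : (m.*2.+2)%:R * wallis m.+1 = (m.*2.+1)%:R * wallis m.
Proof.
by rewrite /= [wallis m * _]mulrC mulrA mulrCA mulfV ?mulr1 // pnatr_eq0.
Qed.

Lemma wallis_bin m : 'C(m.*2, m)%:R / 2 ^+ m.*2 = wallis m.
Proof.
elim: m => [|m IH]; first by rewrite bin0 expr0 divr1.
have E : (m.+1 * 'C(m.+1.*2, m.+1) = 2 * (m.*2.+1 * 'C(m.*2, m)))%N.
  have h := mul_bin_diag m.*2.+1 m; rewrite /= in h.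
  rewrite doubleS binS.
  have -> : 'C(m.*2.+1, m) = 'C(m.*2.+1, m.+1).
    by rewrite -bin_sub; [congr 'C(_, _); lia|lia].
  by rewrite h mulnDr addnn mul2n.
apply: (@mulfI _ (m.*2.+2)%:R); first by rewrite pnatr_eq0.
rewrite wallisS -IH !mulrA doubleS !exprS.
have -> : (m.*2.+2)%:R = 2 * m.+1%:R :> R by rewrite -natrM -doubleS mul2n.
rewrite -(mulrA 2) -natrM -doubleS E !natrM; field.
by rewrite expf_neq0 // pnatr_eq0.
Qed.

(** By the recurrence, the weight of level 2l+2 is that of level 2l times (2l+1)/(2l+2) times
    (A+1)/A, where A = 2m-2l-1. Dropping the last factor leaves the ratio of consecutive [wallis]
    numbers. *)
Lemma tie_weight m l : (l <= m)%N ->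
  wallis m ^+ 2 * wallis l <= 'C(m.*2, l.*2)%:R * scoef (m.*2 - l.*2) l.*2 (tie m) ^+ 2.
Proof.
elim: l => [|l IH] lm; first by rewrite bin0 subn0 scoef_tie0 wallis_bin mul1r mulr1.
pose A := (m.*2 - l.*2.+1)%N.
have A0 : 0 < A%:R :> R by rewrite ltr0n /A; lia.
have := @scoef_tie_rec m A l.*2.+1; rewrite /A subnK; last by lia.
have -> : (m.*2 - l.*2.+1).-1 = (m.*2 - l.+1.*2)%N by lia.
have -> : (m.*2 - l.*2.+1).+1 = (m.*2 - l.*2)%N by lia.
move=> /(_ erefl) /=; rewrite -/A.
set z := scoef _ _ _; set z' := scoef _ _ _ => E.
have Cb : (l.*2.+2)%:R * ((l.*2.+1)%:R * 'C(m.*2, l.*2.+2)%:R) =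
    A%:R * ((A.+1)%:R * 'C(m.*2, l.*2)%:R) :> R.
  rewrite mulrCA -!natrM; congr (_%:R).
  rewrite mul_bin_left mulnCA mul_bin_left /A.
  have -> : (m.*2 - l.*2 = A.+1)%N by rewrite /A; lia.
  by rewrite /A.
rewrite doubleS.
have B0 : 0 < (l.*2.+1)%:R :> R by rewrite ltr0n.
have B20 : 0 < (l.*2.+2)%:R :> R by rewrite ltr0n.
rewrite -(ler_pM2l B20) mulrCA wallisS.
have zE : z = - ((l.*2.+1)%:R * z') / A%:R.
  by rewrite -E mulrC mulKf // gt_eqF.
apply: (@le_trans _ _ ((l.*2.+1)%:R * ('C(m.*2, l.*2)%:R * z' ^+ 2))).
  by rewrite mulrCA ler_wpM2l ?ler0n // IH // ltnW.
have -> : (l.*2.+2)%:R * ('C(m.*2, l.*2.+2)%:R * z ^+ 2) =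
   (l.*2.+1)%:R * ('C(m.*2, l.*2)%:R * z' ^+ 2) * ((A.+1)%:R / A%:R).
  have Cb' : (l.*2.+2)%:R * 'C(m.*2, l.*2.+2)%:R =
    A%:R * ((A.+1)%:R * 'C(m.*2, l.*2)%:R) / (l.*2.+1)%:R :> R.
    by rewrite -Cb mulrCA [RHS]mulrC mulKf // gt_eqF.
  rewrite mulrA Cb' zE; move: (A.+1%:R) => A1.
  move: (A%:R) (l.*2.+1%:R) A0 B0 => p q p0 q0.
  by field; rewrite !gt_eqF.
rewrite ler_peMr //; first by rewrite mulr_ge0 ?ler0n // mulr_ge0 ?ler0n ?sqr_ge0.
by rewrite ler_pdivlMr // mul1r ler_nat.
Qed.

(** The Taylor polynomial of asin of degree 2m+1. *)
Definition asin_sum m (x : R) : R :=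
  \sum_(l < m.+1) wallis l * x ^+ l.*2.+1 / (l.*2.+1)%:R.

Lemma sum_signs n (x : cube n) :
  \sum_(i < n) (if x i then 1 else -1) = 2 * (\sum_(i < n) (x i : nat))%N%:Z - n%:Z :> int.
Proof.
have -> : n%:Z = \sum_(i < n) 1 by rewrite sumr_const card_ord natz.
rewrite -natz natr_sum mulr_sumr -sumrB.
by apply: eq_bigr => i _; case: (x i).
Qed.

Lemma Maj_of_count m (x : cube m.*2.+1) :
  sgnv R (Maj x) = of_count (fun j => if (m < j)%N then 1 else -1) x.
Proof.
rewrite /Maj /of_count /sgnv.
rewrite sum_signs.
move: (\sum_(i < _) _)%N => N.
by have -> : (0 < 2 * N%:Z - m.*2.+1%:Z)%R = (m < N)%N by lia.
Qed.

(** A voter is decisive exactly when the 2m others tie, so the coefficients of majority at size i+1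
    are those of [tie m] at size i. *)
Lemma energy_Maj_ge m rho : 0 <= rho ->
  (m.*2.+1)%:R * wallis m ^+ 2 * asin_sum m rho <=
  energy (fun k => rho ^+ k) (fun x : cube m.*2.+1 => sgnv R (Maj x)).
Proof.
move=> r0; rewrite (eq_energy (m' := fun k => rho ^+ k)
  (f' := of_count (fun j => if (m < j)%N then 1 else -1))) //; last first.
  by move=> x; exact: Maj_of_count.
rewrite energy_of_count big_ord_recl; set F := fun j => _.
have FZ : sdiff F = tie m.
  apply: funext => j; rewrite /sdiff /F /tie ltnS.
  by case: (ltngtP j m) => _ /=; rewrite ?subrr ?mul0r // opprK -[1 + 1]/(2%:R) divff ?pnatr_eq0.
apply: (@le_trans _ _ (\sum_(i < m.*2.+1) 'C(m.*2.+1, i.+1)%:R *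
   (rho ^+ i.+1 * scoef (m.*2 - i) i (tie m) ^+ 2))); last first.
  rewrite bin0 subn0 /= expr0 !mul1r ler_wpDl ?sqr_ge0 //.
  by apply: ler_sum => i _; rewrite -FZ scoef_sdiff subSS.
pose t i : R := 'C(m.*2.+1, i.+1)%:R * (rho ^+ i.+1 * scoef (m.*2 - i) i (tie m) ^+ 2).
have t0 i : 0 <= t i.
  by apply: mulr_ge0; [exact: ler0n|apply: mulr_ge0; [exact: exprn_ge0|exact: sqr_ge0]].
have -> : \sum_(i < m.*2.+1) 'C(m.*2.+1, i.+1)%:R *
   (rho ^+ i.+1 * scoef (m.*2 - i) i (tie m) ^+ 2) = \sum_(i < m.*2.+1) t i by [].
(* Only the odd levels of majority are kept; the other terms are nonnegative. *)
apply: (@le_trans _ _ (\sum_(l < m.+1) t l.*2)); last first.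
  elim: (m) => [|k IH]; first by rewrite !big_ord1.
  rewrite [leLHS]big_ord_recr doubleS [leRHS]big_ord_recr /= lerD //.
  by rewrite [leRHS]big_ord_recr ler_wpDr.
rewrite mulr_sumr ler_sum // => -[l /= lm] _.
rewrite ltnS in lm; have h := tie_weight lm.
have Cb : (m.*2.+1)%:R * 'C(m.*2, l.*2)%:R = (l.*2.+1)%:R * 'C(m.*2.+1, l.*2.+1)%:R :> R.
  by rewrite -!natrM mul_bin_diag.
have B0 : 0 < (l.*2.+1)%:R :> R by rewrite ltr0n.
rewrite /t -(ler_pM2l B0) [leRHS]mulrA -Cb.
have := ler_wpM2l (mulr_ge0 (ler0n R (m.*2.+1)) (exprn_ge0 l.*2.+1 r0)) h.
have -> : (l.*2.+1)%:R * ((m.*2.+1)%:R * wallis m ^+ 2 *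
    (wallis l * rho ^+ l.*2.+1 / (l.*2.+1)%:R)) =
  (m.*2.+1)%:R * rho ^+ l.*2.+1 * (wallis m ^+ 2 * wallis l).
  by move: B0; move: (l.*2.+1%:R : R) => p p0; field; rewrite gt_eqF.
move=> /le_trans; apply; rewrite le_eqVlt; apply/orP; left; apply/eqP; ring.
Qed.

(* Antiderivatives of sin^(2m) and sin^(2m+1), from Wallis's reduction formula. *)
Fixpoint sin_even_int m (x : R) : R :=
  if m is m'.+1 then
    m'.*2.+2%:R^-1 * (m'.*2.+1%:R * sin_even_int m' x - sin x ^+ m'.*2.+1 * cos x)
  else x.

Fixpoint sin_odd_int m (x : R) : R :=
  if m is m'.+1 then
    m'.*2.+3%:R^-1 * (m'.*2.+2%:R * sin_odd_int m' x - sin x ^+ m'.*2.+2 * cos x)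
  else 1 - cos x.

Lemma is_derive_expr k (x : R) : is_derive x 1 (fun y => y ^+ k.+1) (k.+1%:R * x ^+ k).
Proof.
apply: DeriveDef; first exact: exprn_derivable.
by rewrite exp_derive /GRing.scale /= mulr1.
Qed.

Lemma is_derive_cmul (c : R) (f : R -> R) (x d : R) : is_derive x 1 f d ->
  is_derive x 1 (fun y => c * f y) (c * d).
Proof. by move=> D; exact: is_deriveZ. Qed.

Lemma is_derive_wallis_step (f : R -> R) k (x : R) :
  is_derive x 1 f (sin x ^+ k) ->
  is_derive x 1 (fun x => k.+2%:R^-1 * (k.+1%:R * f x - sin x ^+ k.+1 * cos x))
    (sin x ^+ k.+2).
Proof.
move=> D.
have D1 := @is_derive1_comp R _ _ x _ _ (is_derive_expr k (sin x)) (is_derive_sin x).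
have D2 := is_deriveM D1 (is_derive_cos x).
have D3 := is_derive_cmul k.+2%:R^-1 (is_deriveB (is_derive_cmul k.+1%:R D) D2).
apply: (is_derive_eq D3); rewrite /GRing.scale /=.
have k0 : k.+2%:R != 0 :> R by rewrite pnatr_eq0.
apply: (mulfI k0); rewrite mulrA mulfV // mul1r.
have -> : sin x ^+ k.+2 = sin x ^+ k * (1 - cos x ^+ 2).
  by rewrite -sin2cos2 -exprD addn2.
have -> : sin x ^+ k.+1 * - sin x = - (sin x ^+ k * (1 - cos x ^+ 2)).
  by rewrite -sin2cos2 -exprD addn2 mulrN -exprSr.
by rewrite -!natr1; ring.
Qed.

Lemma is_derive_sin_even_int m (x : R) :
  is_derive x 1 (sin_even_int m) (sin x ^+ m.*2).
Proof.
elim: m => [|m IH]; first by rewrite expr0; exact: is_derive_id.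
by rewrite doubleS; exact: is_derive_wallis_step.
Qed.

Lemma is_derive_sin_odd_int m (x : R) :
  is_derive x 1 (sin_odd_int m) (sin x ^+ m.*2.+1).
Proof.
elim: m => [|m IH]; last by rewrite doubleS; exact: is_derive_wallis_step.
by rewrite expr1; apply: is_derive_eq; rewrite /GRing.scale /=; ring.
Qed.

Lemma sin_even_int_pihalf m : sin_even_int m (pi / 2) = wallis m * (pi / 2).
Proof.
elim: m => [|m IH] /=; first by rewrite mul1r.
rewrite IH cos_pihalf mulr0 subr0; move: (_%:R^-1) => q; ring.
Qed.

Lemma sin_odd_int_pihalf m :
  m.*2.+1%:R * wallis m * sin_odd_int m (pi / 2) = 1.
Proof.
elim: m => [|m IH] /=; first by rewrite cos_pihalf subr0 !mul1r.
rewrite cos_pihalf mulr0 subr0 doubleS -[RHS]IH.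
have k0 : m.*2.+2%:R != 0 :> R by rewrite pnatr_eq0.
have k1 : m.*2.+3%:R != 0 :> R by rewrite pnatr_eq0.
move: k0 k1 (sin_odd_int _ _) => {IH}.
move: (m.*2.+3%:R : R) (m.*2.+2%:R : R) (m.*2.+1%:R : R) => p q r q0 p0 z.
by field; rewrite q0 p0.
Qed.

(** Integrating sin^(2m+1) <= sin^(2m) over [0, pi/2] gives 1 / ((2m+1) W) <= W pi / 2 for W =
    [wallis m]. *)
Lemma wallis_ge m : 2 / pi <= m.*2.+1%:R * wallis m ^+ 2.
Proof.
have pi0 := @pi_gt0 R.
have : sin_odd_int m (pi / 2) <= sin_even_int m (pi / 2).
  suff : sin_even_int m 0 - sin_odd_int m 0 <= sin_even_int m (pi / 2) - sin_odd_int m (pi / 2).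
    have E0 : sin_even_int m 0 = 0.
      by elim: m => //= k ->; rewrite sin0 exprS !(mul0r, mulr0) subrr mulr0.
    have O0 : sin_odd_int m 0 = 0.
      elim: m {E0} => [|k IH] /=; first by rewrite cos0 subrr.
      by rewrite IH sin0 exprS !(mul0r, mulr0) subrr mulr0.
    by rewrite E0 O0 subr0 subr_ge0.
  apply: (@is_derive_ge0_le R (fun x => sin_even_int m x - sin_odd_int m x)
    (fun x => sin x ^+ m.*2 - sin x ^+ m.*2.+1)).
  - by rewrite divr_ge0 ?ltW.
  - move=> x _; have D1 := is_derive_sin_even_int m x; have D2 := is_derive_sin_odd_int m x.
    exact: (is_deriveB D1 D2).
  move=> x /andP[x0 x1]; have s0 : 0 <= sin x.
    by apply: sin_ge0_pi; rewrite x0 (le_trans x1) //; lra.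
  by rewrite subr_ge0 exprS ler_piMl ?exprn_ge0 // sin_le1.
rewrite sin_even_int_pihalf => h.
have w0 : 0 < m.*2.+1%:R * wallis m by rewrite mulr_gt0 ?ltr0n ?wallis_gt0.
have := ler_wpM2l (ltW w0) h; rewrite sin_odd_int_pihalf => h2.
rewrite ler_pdivrMr //; have -> : m.*2.+1%:R * wallis m ^+ 2 * pi =
  2 * (m.*2.+1%:R * wallis m * (wallis m * (pi / 2))) by field.
by rewrite ler_peMr.
Qed.

Fixpoint asin_sum_d m (x : R) : R :=
  if m is m'.+1 then asin_sum_d m' x + wallis m * x ^+ m'.*2.+2 else 1.

Fixpoint asin_sum_d2 m (x : R) : R :=
  if m is m'.+1 then asin_sum_d2 m' x + wallis m * (m'.*2.+2%:R * x ^+ m'.*2.+1) else 0.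

Lemma is_derive_asin_sum m (x : R) : is_derive x 1 (asin_sum m) (asin_sum_d m x).
Proof.
elim: m => [|m IH].
  have -> : asin_sum 0 = id by apply: funext => y; rewrite /asin_sum big_ord1 /= mul1r expr1 divr1.
  exact: is_derive_id.
have k0 : m.*2.+3%:R != 0 :> R by rewrite pnatr_eq0.
have -> : asin_sum m.+1 = (fun y => asin_sum m y +
    (wallis m.+1 / m.*2.+3%:R) * y ^+ m.*2.+3).
  by apply: funext => y; rewrite /asin_sum big_ord_recr /= doubleS mulrAC.
have D := is_derive_cmul (wallis m.+1 / m.*2.+3%:R) (is_derive_expr m.*2.+2 x).
by have := is_deriveD IH D; rewrite mulrA divfK.
Qed.

Lemma is_derive_asin_sum_d m (x : R) :
  is_derive x 1 (asin_sum_d m) (asin_sum_d2 m x).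
Proof.
elim: m => [|m IH]; first exact: is_derive_cst.
exact: is_deriveD IH (is_derive_cmul (wallis m.+1) (is_derive_expr m.*2.+1 x)).
Qed.

(* The differential equation of (1 - x^2)^(-1/2), up to the truncation term. *)
Lemma asin_sum_ode m (x : R) :
  asin_sum_d2 m x * (1 - x ^+ 2) - asin_sum_d m x * x =
  - (m.*2.+1%:R * wallis m * x ^+ m.*2.+1).
Proof.
elim: m => [|m IH]; first by rewrite /= expr1 mul0r sub0r mulr1.
have W := wallisS m.
have -> : asin_sum_d2 m.+1 x = asin_sum_d2 m x + wallis m.+1 * (m.*2.+2%:R * x ^+ m.*2.+1) by [].
have -> : asin_sum_d m.+1 x = asin_sum_d m x + wallis m.+1 * x ^+ m.*2.+2 by [].
move: W IH; move: (wallis m.+1) (wallis m) (asin_sum_d2 m x) (asin_sum_d m x) => w w' a b W IH.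
have -> : (a + w * (m.*2.+2%:R * x ^+ m.*2.+1)) * (1 - x ^+ 2) - (b + w * x ^+ m.*2.+2) * x =
  (a * (1 - x ^+ 2) - b * x) + m.*2.+2%:R * w * x ^+ m.*2.+1 * (1 - x ^+ 2) - w * x ^+ m.*2.+2 * x by ring.
rewrite IH W doubleS.
have -> : m.*2.+1%:R * w' = m.*2.+2%:R * w by [].
by rewrite -[m.*2.+3%:R]natr1 !exprS; ring.
Qed.

Lemma wallis_le1 m : wallis m <= 1.
Proof.
elim: m => //= m IH; rewrite mulr_ile1 ?divr_ge0 ?ler0n ?(ltW (wallis_gt0 m)) //.
by rewrite ler_pdivrMr ?ltr0n // mul1r ler_nat.
Qed.

(** The derivative H of y -> asin_sum m (sin y) is 1 at 0, and by [asin_sum_ode] its own derivative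
    is at least -K on [0, th]. Hence H >= 1 - K th there, and integrating once more gives th - K
    th^2. *)
Lemma asin_sum_ge m (th : R) : 0 <= th <= pi / 2 ->
  th - m.*2.+1%:R * sin th ^+ m.*2.+1 * th ^+ 2 <= asin_sum m (sin th).
Proof.
move=> /andP[th0 th1]; set K := m.*2.+1%:R * _.
have pi0 := @pi_gt0 R.
have sin_mono (y z : R) : 0 <= y -> y <= z -> z <= pi / 2 -> sin y <= sin z.
  move=> y0 yz zp; rewrite le_eqVlt; case: (ltgtP y z) yz => // [yz|->] _; last by rewrite eqxx.
  apply/orP; right; rewrite ltr_sin //; rewrite in_itv /=; apply/andP; split; lra.
have sin0' (y : R) : 0 <= y -> y <= pi / 2 -> 0 <= sin y.
  by move=> y0 y1; rewrite -[leLHS]sin0 sin_mono.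
have K0 : 0 <= K by rewrite mulr_ge0 ?ler0n ?exprn_ge0 // sin0'.
pose H y : R := asin_sum_d m (sin y) * cos y.
have DH (y : R) : is_derive y 1 H (- (m.*2.+1%:R * wallis m * sin y ^+ m.*2.+1)).
  have D1 := @is_derive1_comp R _ _ y _ _ (is_derive_asin_sum_d m (sin y)) (is_derive_sin y).
  have D := is_deriveM D1 (is_derive_cos y).
  apply: (is_derive_eq D); rewrite -asin_sum_ode -cos2sin2 /GRing.scale /=; ring.
have H0 : H 0 = 1.
  by rewrite /H sin0 cos0 mulr1; elim: (m) => //= k ->; rewrite exprS mul0r mulr0 addr0.
have Hge (y : R) : 0 <= y <= th -> 1 - K * th <= H y.
  move=> /andP[y0 y1].
  have : H 0 + K * 0 <= H y + K * y.
    apply: (@is_derive_ge0_le R (fun y => H y + K * y)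
      (fun y => - (m.*2.+1%:R * wallis m * sin y ^+ m.*2.+1) + K * 1) _ _ y0
      (fun z _ => is_deriveD (DH z) (is_derive_cmul K (is_derive_id z 1)))) => z /andP[z0 z1].
    have zp : z <= pi / 2 by lra.
    rewrite mulr1 addrC subr_ge0 /K -mulrA ler_wpM2l ?ler0n //.
    apply: (@le_trans _ _ (sin z ^+ m.*2.+1)).
      by rewrite ler_piMl ?wallis_le1 // exprn_ge0 // sin0'.
    by rewrite lerXn2r ?nnegrE ?sin0' // sin_mono // (le_trans z1).
  rewrite H0 mulr0 addr0; have := ler_wpM2l K0 y1; lra.
have : asin_sum m (sin 0) - (1 - K * th) * 0 <= asin_sum m (sin th) - (1 - K * th) * th.
  have D1 z := @is_derive1_comp R _ _ z _ _ (is_derive_asin_sum m (sin z)) (is_derive_sin z).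
  apply: (@is_derive_ge0_le R (fun y => asin_sum m (sin y) - (1 - K * th) * y)
    (fun y => H y - (1 - K * th) * 1) _ _ th0
    (fun z _ => is_deriveB (D1 z) (is_derive_cmul (1 - K * th) (is_derive_id z 1)))) => z zI.
  by rewrite mulr1 subr_ge0 Hge.
have -> : asin_sum m (sin 0) = 0.
  by rewrite sin0 /asin_sum big1 // => i _; rewrite exprS mul0r mulr0 mul0r.
by rewrite mulr0 subr0 subr_ge0; apply: le_trans; rewrite expr2; lra.
Qed.

Lemma energy_Maj_lower m (th : R) : 0 <= th <= pi / 2 ->
  2 / pi * (th - m.*2.+1%:R * sin th ^+ m.*2.+1 * th ^+ 2) <=
  energy (fun k => sin th ^+ k) (fun x : cube m.*2.+1 => sgnv R (Maj x)).
Proof.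
move=> thI; have s0 : 0 <= sin th.
  case/andP: thI => h0 h1; apply: sin_ge0_pi; rewrite h0 (le_trans h1) //.
  by have := @pi_gt0 R; lra.
apply: le_trans (energy_Maj_ge m s0).
apply: le_trans (ler_wpM2l _ (asin_sum_ge m thI)) _; first by rewrite divr_ge0 ?pi_ge0.
rewrite ler_wpM2r ?wallis_ge // /asin_sum sumr_ge0 // => i _.
by rewrite divr_ge0 ?ler0n // mulr_ge0 ?exprn_ge0 // ltW // wallis_gt0.
Qed.

End SymmetricFunctions.

(** * Majority is stablest *)

Section MajorityIsStablest.
Variable R : realType.

Lemma sin_asin_third : sin (asin (1 / 3)) = 1 / 3 :> R.
Proof. by apply: asinK; rewrite in_itv /=; apply/andP; split; lra. Qed.

Lemma asin_third_lt : asin (1 / 3) < pi / 2 :> R.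
Proof. by apply: asin_ltpi2; apply/andP; split; lra. Qed.

Lemma asin_third_gt0 : 0 < asin (1 / 3) :> R.
Proof.
rewrite ltNge; apply/negP => h; have := sin_asin_third.
have l : - (pi / 2) <= asin (1 / 3) :> R by apply: asin_geNpi2; apply/andP; split; lra.
have : 0 <= sin (- asin (1 / 3)) :> R.
  by apply: sin_ge0_pi; move: l h; have := @pi_gt0 R; move: (asin _) => a *; apply/andP; split; lra.
by rewrite sinN => ? ?; lra.
Qed.

Lemma exists_nat_ge (x : R) : exists n : nat, x <= n%:R.
Proof.
by exists (Num.bound `|x|); apply: le_trans (ler_norm x) (ltW (archi_boundP (normr_ge0 x))).
Qed.

Lemma majority_is_stablest (eps : R) : 0 < eps -> exists eta tau : R,
  [/\ 0 <= eta < 1, 0 < tau & forall n (f : cube n -> R),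
    (forall x, `|f x| <= 1) -> uexpect f = 0 ->
    (forall i, rinf i (mult (fun k => eta ^+ k) f) <= tau) ->
    energy (fun k => (1 / 3) ^+ k) f <= 2 / pi * asin (1 / 3) + eps].
Proof.
(* d is the defect of both kappa = 1/2 - d and eta = 1 - d; together they cost 7 d in the end. *)
move=> eps0; pose d := Num.min eps 1 / 16.
have m0 : 0 < Num.min eps 1 by rewrite lt_min eps0 ltr01.
have m1 : Num.min eps 1 <= eps by rewrite ge_min lexx.
have m2 : Num.min eps 1 <= 1 by rewrite ge_min lexx orbT.
have d0 : 0 < d by rewrite divr_gt0.
have d1 : d <= eps / 16 by rewrite ler_wpM2r // invr_ge0.
have d2 : d <= 1 / 16 by rewrite ler_wpM2r // invr_ge0.
have kI : 0 < 1 / 2 - d < 1 / 2 by apply/andP; split; lra.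
have [J [C [C0]]] := borell_rho_concave asin_third_gt0 asin_third_lt kI.
rewrite sin_asin_third => JC J00 JM.
pose c := eps / (16 * (8 * C + 1)).
have D0 : 0 < 8 * C + 1 by lra.
have c0 : 0 < c by rewrite divr_gt0 // mulr_gt0.
have cC : 8 * C * (3 * c) <= eps / 4.
  have cE : c * (8 * C + 1) = eps / 16 by rewrite /c; field; rewrite gt_eqF.
  by nra.
(* N makes eta^(2N) at most c/2, as N d eta^N <= 1; then tau makes the low-degree term equal to c,
   so the three error terms total at most 3 c. *)
have [N HN] := exists_nat_ge (2 / (c * d)).
pose eta := 1 - d; pose tau := c ^+ 2 / 9 ^+ N.
have p9 : 0 < 9 ^+ N :> R by rewrite exprn_gt0.
have tau0 : 0 < tau by rewrite divr_gt0 // exprn_gt0.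
have eta0 : 0 <= eta by rewrite /eta; lra.
have eta1 : eta < 1 by rewrite /eta; lra.
have etaN : eta ^+ (2 * N) <= c / 2.
  apply: (@le_trans _ _ (eta ^+ N)).
    by apply: ler_wiXn2l; rewrite ?eta0 ?(ltW eta1) // mul2n -addnn leq_addr.
  have h := natr_pow_le N eta0 eta1; rewrite opprB addrC subrK in h.
  have cd : 0 < c * d by rewrite mulr_gt0.
  rewrite ler_pdivrMr // in HN.
  have p0 := exprn_ge0 N eta0.
  have := ler_wpM2r p0 HN; move: h; move: (eta ^+ N) (N%:R : R) => p q h1 h2.
  have := ler_wpM2l (ltW c0) h1; nra.
exists eta, tau; split => [||n f f1 f0 finf] //; first by rewrite eta0.
have eta01 : 0 <= eta <= 1 by rewrite eta0 ltW.
have r0 : 0 <= 1 / 3 :> R by lra.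
have r1 : 1 / 3 < 1 :> R by lra.
have := low_influence_stability N r0 r1 eta01 c0 (ltW tau0) C0 JC JM f1 f0 finf.
have := noise_stability_cont r0 r1 eta01 f1.
set X' := energy _ (mult _ f) => h1; rewrite J00 => h2.
have X'1 : X' <= 1.
  apply: le_trans (energy_le1 (noise_norm_le1 eta01 f1)); apply: le_energy => k.
  by rewrite exprn_ile1 ?r0 // ltW.
have X'0 : 0 <= X' by apply: energy_ge0 => k; exact: exprn_ge0.
have pi0 := @pi_gt0 R.
have E1 : c^-1 * (9 ^+ N * tau) = c by rewrite /tau; field; rewrite !gt_eqF.
rewrite E1 in h2.
have h3 : 2 * C * (c + c + 2 * eta ^+ (2 * N)) <= 2 * C * (3 * c).
  by rewrite ler_wpM2l ?mulr_ge0 //; lra.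
have h4 : 2 * (1 - eta) / (1 - 1 / 3) = 3 * d by rewrite /eta; field.
have h5 : 2 / pi * asin (1 / 3) = 4 * (asin (1 / 3) / (2 * pi)) :> R.
  by move: pi0; move: (pi : R) => p p0; field; rewrite lt0r_neq0.
rewrite h4 in h1; rewrite h5.
move: h2 cC h3; rewrite -/X'; move: (asin _ / _) => B h2 cC h3.
(* Replacing kappa by 1/2 costs (4 d - 4 d^2) X', and X' <= 1. *)
have h6 : X' <= 4 * ((1 / 2 - d) ^+ 2 * X') + 4 * d.
  have : (1 - 4 * (1 / 2 - d) ^+ 2) * X' <= 4 * d * 1.
    by apply: ler_pM => //; have := sqr_ge0 d; nra.
  by lra.
lra.
Qed.

Lemma sgnv_norm b : `|sgnv R b| <= 1.
Proof. by case: b; rewrite /sgnv ?normrN normr1. Qed.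

Lemma rational_boundE : rational_bound R = 3 / 4 + 3 / 4 * (2 / pi * asin (1 / 3)).
Proof.
rewrite /rational_bound; have := @pi_gt0 R; move: (pi : R) => p p0.
by field; rewrite lt0r_neq0.
Qed.

Lemma rational_prob_low_influence (eps : R) : 0 < eps ->
  exists2 tau : R, 0 < tau & forall n (f : bfun n), odd_bfun f ->
    (forall i, influence R i f <= tau) -> rational_prob R f <= rational_bound R + eps.
Proof.
move=> /[dup] eps0 /majority_is_stablest[eta [tau [/andP[eta0 eta1] tau0 H]]].
exists tau => // n f fodd finf; rewrite rational_prob_energy // rational_boundE.
have := H n (fun x => sgnv R (f x)) (fun x => sgnv_norm _) (odd_balanced R fodd).
have finf' i : rinf i (mult (fun k => eta ^+ k) (fun x => sgnv R (f x))) <= tau.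
  apply: le_trans (finf i); rewrite influence_rinf; apply: rinf_mult => k.
  by rewrite ger0_norm ?exprn_ge0 // exprn_ile1 // ltW.
by move=> /(_ finf'); move: (energy _ _) (2 / pi * _) => X B; lra.
Qed.

(** The total influence of the noisy function is at most 1 / (1 - eta^2) by [natr_pow_le], and it is
    shared equally by n coordinates. *)
Lemma rational_prob_transitive (eps : R) : 0 < eps ->
  exists n0 : nat, forall n (f : bfun n), (n0 <= n)%N -> odd_bfun f ->
    transitive_symmetric f -> rational_prob R f <= rational_bound R + eps.
Proof.
move=> /[dup] eps0 /majority_is_stablest[eta [tau [/andP[eta0 eta1] tau0 H]]].
have q1 : eta ^+ 2 < 1 by rewrite exprn_ilt1.
have q0 : 0 <= eta ^+ 2 by exact: sqr_ge0.
have [n0 Hn0] := exists_nat_ge ((1 - eta ^+ 2)^-1 / tau).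
(* The successor ensures that n is positive. *)
exists n0.+1 => n f nn0 fodd ftr; rewrite rational_prob_energy // rational_boundE.
have f1 x : `|sgnv R (f x)| <= 1 by exact: sgnv_norm.
have := H n (fun x => sgnv R (f x)) f1 (odd_balanced R fodd).
have finf i : rinf i (mult (fun k => eta ^+ k) (fun x => sgnv R (f x))) <= tau.
  have tr (k l : 'I_n) : (k < l)%N ->
     exists2 s : 'S_n, s k = l & forall x, sgnv R (f x) = sgnv R (f (permute s x)).
    by move=> /ftr[s sk fs]; exists s => // x; rewrite (fs x).
  have np : 0 < n%:R :> R by rewrite ltr0n (leq_trans _ nn0).
  rewrite -(ler_pM2l np) (rinf_noise_symmetric eta i tr).
  have c0 : 0 < (1 - eta ^+ 2)^-1 by rewrite invr_gt0 subr_gt0.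
  apply: (@le_trans _ _ (1 - eta ^+ 2)^-1).
    rewrite -[leRHS]mulr1; apply: le_trans (ler_wpM2l (ltW c0) (energy_le1 f1)).
    rewrite -energyZ; apply: le_energy => k.
    by rewrite mulr1 -[leRHS]mul1r ler_pdivlMr ?subr_gt0 // exprAC natr_pow_le.
  rewrite -ler_pdivrMr //; apply: le_trans Hn0 _.
  by rewrite ler_nat ltnW.
by move=> /(_ finf); move: (energy _ _) (2 / pi * _) => X B; lra.
Qed.

Lemma Maj_odd m : odd_bfun (@Maj m.*2.+1).
Proof.
move=> x; rewrite /Maj; have := sum_signs x.
have -> : \sum_(i < m.*2.+1) (if cube_opp x i then 1 else -1) =
    - \sum_(i < m.*2.+1) (if x i then 1 else -1) :> int.
  by rewrite -sumrN; apply: eq_bigr => i _; rewrite ffunE; case: (x i).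
by move: (\sum_(i < _) _) (\sum_(i < _) _)%N => z N; lia.
Qed.

Lemma Maj_transitive n : transitive_symmetric (@Maj n).
Proof.
move=> i j _; exists (tperm i j) => [|x]; first exact: tpermL.
rewrite /Maj (reindex_inj (@perm_inj _ (tperm i j))) /=.
by congr (0 < _); apply: eq_bigr => k _; rewrite ffunE.
Qed.

(** Turns the truncation error n (1/3)^n into the rate 1/n. *)
Lemma sqrn_le_exp3 n : (n ^ 2 <= 3 ^ n)%N.
Proof.
elim: n => [|[|[|n]] IH] //.
have := IH; rewrite !expnS; move: (3 ^ n)%N => p; nia.
Qed.

Lemma rational_prob_Maj_ge m : rational_bound R -
  3 / 4 * (2 / pi * asin (1 / 3) ^+ 2) / m.*2.+1%:R <= rational_prob R (@Maj m.*2.+1).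
Proof.
rewrite rational_prob_energy; last exact: Maj_odd.
have thI : 0 <= (asin (1 / 3) : R) <= pi / 2.
  by rewrite (ltW asin_third_gt0) (ltW asin_third_lt).
have := energy_Maj_lower m thI; rewrite sin_asin_third rational_boundE.
set X := energy _ _; set th := asin _ => h.
have n0 : 0 < m.*2.+1%:R :> R by rewrite ltr0n.
have K : m.*2.+1%:R * (1 / 3) ^+ m.*2.+1 <= m.*2.+1%:R^-1 :> R.
  rewrite -[leRHS]div1r ler_pdivlMr // div1r exprVn mulrAC ler_pdivrMr ?exprn_gt0 //.
  by rewrite mul1r -natrX -natrM ler_nat mulnn sqrn_le_exp3.
have pi0 : 0 <= 2 / pi :> R by rewrite divr_ge0 ?pi_ge0.
have := ler_wpM2l pi0 (ler_wpM2r (sqr_ge0 th) K).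
move: h; move: (_ * _ ^+ _ : R) (m.*2.+1%:R^-1 : R) (2 / pi) => k n q; lra.
Qed.

(** Majority is odd and transitive-symmetric, so the upper half is [rational_prob_transitive]; the
    lower half is [rational_prob_Maj_ge]. *)
Lemma cvg_rational_prob_Maj :
  (fun m : nat => rational_prob R (@Maj m.*2.+1)) @ \oo --> rational_bound R.
Proof.
apply/cvgrPdist_le => eps eps0.
have [n0 Hup] := rational_prob_transitive eps0.
set T := 3 / 4 * (2 / pi * asin (1 / 3) ^+ 2) : R.
have [m0 Hm0] := exists_nat_ge (T / eps).
exists (n0 + m0)%N => // m /= mm.
have up := Hup _ (@Maj m.*2.+1) (ltac:(lia)) (@Maj_odd m) (@Maj_transitive _).
have lo := rational_prob_Maj_ge m; rewrite -/T in lo.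
have h : T / m.*2.+1%:R <= eps.
  rewrite ler_pdivrMr ?ltr0n // mulrC -ler_pdivrMr //; apply: le_trans Hm0 _.
  by rewrite ler_nat; lia.
move: up lo h; move: (rational_prob _ _) (rational_bound _) (T / _) => p b t up lo h.
by rewrite ler_norml; apply/andP; split; lra.
Qed.

End MajorityIsStablest.

Theorem theorem2p9 (R : realType) :
  [/\ forall eps : R, 0 < eps ->
        exists2 tau : R, 0 < tau &
          forall (n : nat) (f : bfun n), odd_bfun f ->
            (forall i : 'I_n, influence R i f <= tau) ->
            rational_prob R f <= rational_bound R + eps,
      forall eps : R, 0 < eps ->
        exists n0 : nat,
          forall (n : nat) (f : bfun n), (n0 <= n)%N ->
            odd_bfun f -> transitive_symmetric f ->
            rational_prob R f <= rational_bound R + eps &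
      (fun m : nat => rational_prob R (@Maj m.*2.+1)) @ \oo --> rational_bound R].
Proof.
split; [exact: rational_prob_low_influence|exact: rational_prob_transitive|].
exact: cvg_rational_prob_Maj.
Qed.
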